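(* Let $A$ be a complete intersection of dimension zero with maximal ideal $M$, let $x=(x_1,\dots,x_n)$ be a sequence generating $M$, let $\psi$ be an $x$-Wiebe matrix for $A$, and put $\mathcal M_0=(\psi\cdot\mathcal M_n(A)+\mathcal N_{x,A})/\mathcal N_{x,A}$. Then the C.I.0-ideals of $A$ are in bijection with the cyclic submodules of the right $\mathcal M_n(A)$-module $\mathcal M_n(A)/\mathcal N_{x,A}$ containing $\mathcal M_0$ (namely, the C.I.0-ideal $J(x\cdot\varphi)$, for $\varphi$ an $x$-nice matrix, corresponds to $(\varphi\cdot\mathcal M_n(A)+\mathcal N_{x,A})/\mathcal N_{x,A}$).
   Context: A complete intersection: a noetherian local ring whose completion is a regular local ring modulo an ideal generated by a regular sequence; a zero-dimensional one is artinian hence complete. $\mathcal M_n(A)$ is the ring of $n\times n$ matrices over $A$. $J(a)$ is the ideal generated by a sequence $a$; $x\cdot\varphi$ is the row matrix product. A matrix $\varphi$ is $x$-nice if $\det(\varphi)\notin J(x\cdot\varphi)$; an $x$-Wiebe matrix for $A$ is a $\psi\in\mathcal M_n(A)$ with $x\cdot\psi=0$ and $\det(\psi)\ne0$. A C.I.0-ideal is a proper ideal $I$ with $A/I$ a complete intersection of dimension $0$. Let $\delta$ be the matrix of the second boundary map $A^{n(n-1)/2}\to A^n$ of the Koszul complex $K_\cdot(x,A)$; the $x$-Koszul ideal is $\mathcal N_{x,A}=\{\alpha\in\mathcal M_n(A):\mathrm{im}(\alpha)\subseteq\mathrm{im}(\delta)\}$, a right ideal of $\mathcal M_n(A)$.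 *)

(* Defs.v *)
From HB Require Import structures.
From mathcomp Require Import all_boot all_order all_algebra.
Set Implicit Arguments. Unset Strict Implicit. Unset Printing Implicit Defensive.
Import Order.TTheory GRing.Theory.
Local Open Scope ring_scope.

Definition surj (S T : Type) (f : S -> T) : Prop := forall t, exists s, f s = t.

Section CommAlg.
Variable R : comNzRingType.

Definition is_ideal (I : R -> Prop) : Prop :=
  I 0 /\ (forall a b, I a -> I b -> I (a + b)) /\ (forall r a, I a -> I (r * a)).

Definition proper_ideal (I : R -> Prop) : Prop := is_ideal I /\ ~ I 1.

Definition sub_ideal (I J : R -> Prop) : Prop := forall a, I a -> J a.
Definition eq_ideal (I J : R -> Prop) : Prop := forall a, I a <-> J a.

Definition prime_ideal (P : R -> Prop) : Prop :=
  proper_ideal P /\ forall a b, P (a * b) -> P a \/ P b.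

Definition maximal_ideal (M : R -> Prop) : Prop :=
  proper_ideal M /\ forall J, is_ideal J -> sub_ideal M J -> eq_ideal J M \/ J 1.

Definition gen_ideal (k : nat) (f : 'I_k -> R) : R -> Prop :=
  fun a => exists c : 'I_k -> R, a = \sum_(i < k) c i * f i.

Definition prefix_ideal (k : nat) (f : 'I_k -> R) (i : nat) : R -> Prop :=
  fun a => exists c : 'I_k -> R, a = \sum_(j < k | (j < i)%N) c j * f j.

Definition finitely_generated (I : R -> Prop) : Prop :=
  exists (k : nat) (f : 'I_k -> R), eq_ideal I (gen_ideal f).

Definition noetherian : Prop :=
  forall I, is_ideal I -> finitely_generated I.

Definition local_with_max (M : R -> Prop) : Prop :=
  maximal_ideal M /\ forall N, maximal_ideal N -> eq_ideal N M.

Definition prime_chain (d : nat) (P : nat -> R -> Prop) : Prop :=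
  (forall i, (i <= d)%N -> prime_ideal (P i)) /\
  (forall i, (i < d)%N -> sub_ideal (P i) (P i.+1) /\ ~ sub_ideal (P i.+1) (P i)).

Definition krull_dim (d : nat) : Prop :=
  (exists P, prime_chain d P) /\ ~ (exists P, prime_chain d.+1 P).

Definition regular_local : Prop :=
  noetherian /\ exists (m : R -> Prop) (d : nat),
    local_with_max m /\ krull_dim d /\ exists f : 'I_d -> R, eq_ideal m (gen_ideal f).

Definition regular_sequence (r : nat) (f : 'I_r -> R) : Prop :=
  ~ gen_ideal f 1 /\
  forall i : 'I_r, forall a, prefix_ideal f i (f i * a) -> prefix_ideal f i a.

End CommAlg.

(* A noetherian local ring of dimension 0 (hence artinian and complete) is a
   complete intersection iff it is (isomorphic to) a regular local ring modulo
   an ideal generated by a regular sequence; the isomorphism R/(f) ~ A is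
   written as a surjective ring morphism R -> A with kernel (f). *)
Definition CI0 (R : comNzRingType) : Prop :=
  noetherian R /\ (exists M : R -> Prop, local_with_max M) /\ krull_dim R 0 /\
  exists (S : comNzRingType) (pi : {rmorphism S -> R}),
    surj pi /\ regular_local S /\
    exists (r : nat) (f : 'I_r -> S),
      regular_sequence f /\ forall s, pi s = 0 <-> gen_ideal f s.



(* C.I.0-ideal: proper ideal I with A/I a complete intersection of dimension 0;
   A/I is written as a surjective ring morphism A -> B with kernel I. *)
Definition CI0_ideal (A : comNzRingType) (I : A -> Prop) : Prop :=
  proper_ideal I /\
  exists (B : comNzRingType) (q : {rmorphism A -> B}),
    surj q /\ (forall a, q a = 0 <-> I a) /\ CI0 B.

Section Matrices.
Variables (A : comNzRingType) (n : nat).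

Definition Jrow (a : 'rV[A]_n) : A -> Prop := gen_ideal (fun i => a 0 i).

Definition x_nice (x : 'rV[A]_n) (phi : 'M[A]_n) : Prop :=
  ~ Jrow (x *m phi) (\det phi).

Definition x_Wiebe (x : 'rV[A]_n) (psi : 'M[A]_n) : Prop :=
  x *m psi = 0 /\ \det psi != 0.

(* basis e_i /\ e_j, i < j, of the second Koszul module *)
Definition koszul_pairs : finType := {p : 'I_n * 'I_n | (p.1 < p.2)%N}.

(* second Koszul boundary map: e_i /\ e_j |-> x_i e_j - x_j e_i *)
Definition koszul_delta (x : 'rV[A]_n) : 'M[A]_(n, #|koszul_pairs|) :=
  \matrix_(k < n, c < #|koszul_pairs|)
    let p := val (enum_val c) in
    if k == p.1 then - x 0 p.2 else if k == p.2 then x 0 p.1 else 0.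

Definition koszul_right_ideal (x : 'rV[A]_n) (alpha : 'M[A]_n) : Prop :=
  exists beta : 'M[A]_(#|koszul_pairs|, n), alpha = koszul_delta x *m beta.

(* preimage in M_n(A) of the cyclic submodule (phi.M_n(A) + N)/N of M_n(A)/N *)
Definition cyclic_sub (x : 'rV[A]_n) (phi : 'M[A]_n) (alpha : 'M[A]_n) : Prop :=
  exists beta : 'M[A]_n, koszul_right_ideal x (alpha - phi *m beta).

End Matrices.

(* Main.v *)
Require Import Defs.
From HB Require Import structures.
From mathcomp Require Import all_boot all_order all_algebra.
From mathcomp Require Import ring.
From Stdlib Require Import Classical ClassicalEpsilon.
Set Implicit Arguments. Unset Strict Implicit. Unset Printing Implicit Defensive.
Import GRing.Theory.
Local Open Scope ring_scope.

(* Let A = S/(f) with S regular local, X generating its maximal ideal m and f a regular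
   sequence; Krull's height theorem and the Koszul complex show that X and f have the same length
   and that X is regular.  If X Phi lies in an m-primary ideal K but det Phi does not, then K is
   generated by the entries of X Phi (Wiebe): perturbing X Phi inside m K, by prime avoidance, gives
   a regular sequence; its socle is spanned by the new determinant, which is congruent to det Phi
   modulo K, so this sequence generates K, and by Nakayama so does X Phi, which is therefore
   regular.  Hence a nice phi defines a complete intersection, and every column z with x z in
   J(x phi) is, modulo the Koszul boundaries, in the image of phi; this gives psi in
   phi M_n(A) + N and the injectivity.  Conversely Wiebe matrices can be
   transferred from one generating sequence of the maximal ideal to another (complete the matrix
   to both sequences, then take a minor), and a determinant of cycles does not
   change when boundaries are added to its columns. *)

(** * Ideals of noetherian rings *)

(** It is not known at first that [X Phi] generates an [m]-primary ideal, so no Koszul argument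
    reaches it directly; this is why it is perturbed. The socle then gives equality as follows.
    Modulo an [m]-primary regular sequence of length [d], every nonzero ideal contains a nonzero
    socle element, hence a unit multiple of the single generator [o] of the socle. So an ideal
    strictly larger than that of the sequence contains [o], and with it the determinant, which
    Cramer's rule puts in the socle. The length [n] of [x] may differ from [d], and [x] need not
    lift to a regular sequence generating [m]; hence the results are proved for the image [y] of [X]
    in [A] and carried to [x] by determinants over joined sequences. Relations in [A] are studied by
    lifting them to [S], because the Koszul complex over [A] may have cycles that are not
    boundaries. Krull's theorem enters twice: for the lengths of [X] and [f], and, in its form for
    one element, to compare primes in the prime avoidance. *)

Section Ideals.
Variable R : comNzRingType.
Implicit Types (I J P Q : R -> Prop) (F G : nat -> R).

Lemma not_sub I J : ~ (forall a, I a -> J a) -> exists a, I a /\ ~ J a.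
Proof. by move/not_all_ex_not => [a h]; exists a; split; [apply: NNPP => n; apply: h|move=> n; apply: h]. Qed.

Lemma ideal0 I : is_ideal I -> I 0. Proof. by case. Qed.
Lemma idealD I a b : is_ideal I -> I a -> I b -> I (a + b).
Proof. by case=> _ [h _]; apply: h. Qed.
Lemma idealMl I r a : is_ideal I -> I a -> I (r * a).
Proof. by case=> _ [_ h]; apply: h. Qed.
Lemma idealMr I r a : is_ideal I -> I a -> I (a * r).
Proof. by rewrite mulrC; apply: idealMl. Qed.
Lemma idealN I a : is_ideal I -> I a -> I (- a).
Proof. by move=> hI; rewrite -mulN1r; apply: idealMl. Qed.
Lemma idealB I a b : is_ideal I -> I a -> I b -> I (a - b).
Proof. by move=> hI ha hb; apply: idealD => //; apply: idealN. Qed.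
Lemma ideal_sum I (T : Type) (s : seq T) (p : pred T) (F : T -> R) :
  is_ideal I -> (forall i, p i -> I (F i)) -> I (\sum_(i <- s | p i) F i).
Proof. by move=> hI h; elim/big_ind: _ => // [|a b]; [apply: ideal0|apply: idealD]. Qed.
Lemma idealBC I a b : is_ideal I -> I (a - b) -> I (b - a).
Proof. by move=> hI h; rewrite -opprB; apply: idealN. Qed.
Lemma idealBr I a b : is_ideal I -> I (a - b) -> I b -> I a.
Proof. by move=> hI h hb; rewrite -(subrK b a); apply: idealD. Qed.
Lemma idealBl I a b : is_ideal I -> I (a - b) -> I a -> I b.
Proof. by move=> hI /(idealBC hI); apply: idealBr. Qed.

Lemma prime_is_ideal P : prime_ideal P -> is_ideal P. Proof. by case=> -[]. Qed.
Lemma prime_n1 P : prime_ideal P -> ~ P 1. Proof. by case=> -[]. Qed.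
Lemma primeX P a t : prime_ideal P -> P (a ^+ t) -> P a.
Proof.
move=> hP; elim: t => [|t IH]; first by rewrite expr0 => /(prime_n1 hP).
by rewrite exprS; case: hP => _ h /h [].
Qed.
Lemma primeNM P a b : prime_ideal P -> ~ P a -> ~ P b -> ~ P (a * b).
Proof. by case=> _ h na nb /h []. Qed.
Lemma primeN_prod P (k : nat) (s : 'I_k -> R) :
  prime_ideal P -> (forall i, ~ P (s i)) -> ~ P (\prod_i s i).
Proof.
move=> hP h; elim/big_ind: _ => //; [exact: prime_n1|].
by move=> a b; apply: primeNM.
Qed.

(** Generators are a function on [nat] cut at [n]: prefix ideals are [idl F k] for the same [F], and
    lengths are compared without casts between ordinals. *)
Definition idl F n : R -> Prop := fun a => exists c : nat -> R, a = \sum_(i < n) c i * F i.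

Lemma ideal_idl F n : is_ideal (idl F n).
Proof.
split; first by exists (fun=> 0); rewrite big1 // => i _; rewrite mul0r.
split=> [_ _ [c ->] [d ->]|r _ [c ->]].
  by exists (fun i => c i + d i); rewrite -big_split; apply: eq_bigr => i _; rewrite mulrDl.
by exists (fun i => r * c i); rewrite mulr_sumr; apply: eq_bigr => i _; rewrite mulrA.
Qed.
Hint Resolve ideal_idl : core.

Lemma mem_idl F n i : (i < n)%N -> idl F n (F i).
Proof.
move=> hi; exists (fun j => (j == i)%:R).
rewrite (bigD1 (Ordinal hi)) //= eqxx mul1r big1 ?addr0 // => j.
by rewrite -val_eqE /= => /negPf ->; rewrite mul0r.
Qed.

Lemma idl_sub F n I : is_ideal I -> (forall i, (i < n)%N -> I (F i)) ->
  forall a, idl F n a -> I a.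
Proof. by move=> hI h _ [c ->]; apply: ideal_sum => // i _; apply: idealMl => //; apply: h. Qed.

Lemma idl_gen n (f : 'I_n -> R) F : (forall i : 'I_n, F i = f i) ->
  eq_ideal (gen_ideal f) (idl F n).
Proof.
move=> h a; split=> -[c ->].
  exists (fun i => if insub i is Some j then c j else 0).
  by apply: eq_bigr => i _; rewrite valK h.
by exists (fun i => c i); apply: eq_bigr => i _; rewrite h.
Qed.

Definition ext n (f : 'I_n -> R) : nat -> R := fun i => if insub i is Some j then f j else 0.
Lemma extE n (f : 'I_n -> R) (i : 'I_n) : ext f i = f i.
Proof. by rewrite /ext valK. Qed.

Definition addel I u : R -> Prop := fun a => exists b r, I b /\ a = b + r * u.
Lemma ideal_addel I u : is_ideal I -> is_ideal (addel I u).
Proof.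
move=> hI; split; first by exists 0, 0; rewrite mul0r addr0; split=> //; apply: ideal0.
split=> [_ _ [b [r [hb ->]]] [c [s [hc ->]]]|t _ [b [r [hb ->]]]].
  by exists (b + c), (r + s); split; [apply: idealD|ring].
by exists (t * b), (t * r); split; [apply: idealMl|ring].
Qed.
Lemma sub_addel I u a : I a -> addel I u a.
Proof. by exists a, 0; rewrite mul0r addr0. Qed.
Lemma mem_addel I u : is_ideal I -> addel I u u.
Proof. by move=> hI; exists 0, 1; rewrite add0r mul1r; split=> //; apply: ideal0. Qed.
Lemma addel_sub I u J : is_ideal J -> (forall a, I a -> J a) -> J u -> forall a, addel I u a -> J a.
Proof. by move=> hJ h hu _ [b [r [hb ->]]]; apply: idealD => //; [apply: h|apply: idealMl]. Qed.

Lemma noeth_fg I : noetherian R -> is_ideal I -> exists n F, eq_ideal I (idl F n).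
Proof.
move=> hR /hR [n [f h]]; exists n, (ext f) => a; rewrite h.
exact: (idl_gen (extE f) a).
Qed.

(** Without a maximal member, dependent choice gives a strictly increasing sequence above [I0]; the
    finitely many generators of its union already lie in one stage [K], against strictness at the
    next. *)
Lemma noeth_max (C : (R -> Prop) -> Prop) I0 :
  noetherian R -> (forall I, C I -> is_ideal I) -> C I0 ->
  exists I, C I /\ (forall a, I0 a -> I a) /\
    forall J, C J -> (forall a, I a -> J a) -> forall a, J a -> I a.
Proof.
move=> hR hC h0; apply: NNPP => hn.
pose T := {I | C I /\ forall a, I0 a -> I a}.
have step (I : T) : {J : T | (forall a, sval I a -> sval J a) /\ exists a, sval J a /\ ~ sval I a}.
  apply: constructive_indefinite_description.
  case: I => I [cI I0I] /=; apply: NNPP => hn2; apply: hn; exists I; split=> //; split=> //.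
  move=> J cJ IJ a ja; apply: NNPP => nIa; apply: hn2.
  have cJ2 : C J /\ forall a, I0 a -> J a by split=> // b /I0I /IJ.
  by exists (exist _ J cJ2); split=> //; exists a.
pose u := fix u (k : nat) : T := if k is k'.+1 then sval (step (u k')) else exist _ I0 (conj h0 (fun a h => h)).
have umono k l a : (k <= l)%N -> sval (u k) a -> sval (u l) a.
  elim: l => [|l IH]; first by rewrite leqn0 => /eqP ->.
  rewrite leq_eqVlt => /orP[/eqP -> //|kl /(IH kl)].
  by have [h _] := svalP (step (u l)); apply: h.
have uid k : is_ideal (sval (u k)) by apply: hC; case: (svalP (u k)).
pose U a := exists k, sval (u k) a.
have hU : is_ideal U.
  split; first by exists 0%N; apply: ideal0.
  split=> [a b [k ka] [l lb]|r a [k ka]]; last by exists k; apply: idealMl.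
  by exists (maxn k l); apply: idealD => //; [apply: umono ka|apply: umono lb];
    rewrite ?leq_maxl ?leq_maxr.
have [n [F hF]] := noeth_fg hR hU.
have [K hK] : exists K, forall i, (i < n)%N -> sval (u K) (F i).
  have : forall i, (i < n)%N -> U (F i) by move=> i hi; apply/hF/mem_idl.
  elim: n {hF} => [|n IH] h; first by exists 0%N.
  have [K hK] := IH (fun i hi => h i (ltnW hi)).
  have [k hk] := h n (ltnSn n).
  exists (maxn K k) => i; rewrite ltnS leq_eqVlt => /orP[/eqP ->|/hK].
    by apply: umono hk; rewrite leq_maxr.
  by apply: umono; rewrite leq_maxl.
have [_ [a [ha na]]] := svalP (step (u K)).
apply: na; apply: (idl_sub (uid K) hK); apply/hF.
by exists K.+1.
Qed.

Lemma noeth_ind (C : (R -> Prop) -> Prop) : noetherian R ->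
  (forall I, is_ideal I ->
     (forall J, is_ideal J -> (forall a, I a -> J a) -> (exists a, J a /\ ~ I a) -> C J) -> C I) ->
  forall I, is_ideal I -> C I.
Proof.
move=> hR step I hI; apply: NNPP => nC.
have [J [[hJ nJ] [_ hmax]]] :=
  @noeth_max (fun I => is_ideal I /\ ~ C I) I hR (fun I h => proj1 h) (conj hI nC).
apply: nJ; apply: step => // K hK JK [a [ha na]]; apply: NNPP => nK.
by apply: na; apply: (hmax K).
Qed.

(** An ideal maximal among those that miss the multiplicative set [T] is prime: for [a], [b] outside
    it, [P + (a)] and [P + (b)] both meet [T], and the product of the two elements found lies in
    [P + (a b)]. *)
Lemma prime_avoid (T : R -> Prop) I : noetherian R -> is_ideal I -> T 1 ->
  (forall a b, T a -> T b -> T (a * b)) -> (forall a, I a -> ~ T a) ->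
  exists P, prime_ideal P /\ (forall a, I a -> P a) /\ (forall a, P a -> ~ T a).
Proof.
move=> hR hI T1 TM hIT.
have [P [[hP hPT] [IP hmax]]] := @noeth_max
  (fun I => is_ideal I /\ forall a, I a -> ~ T a) I hR (fun I h => proj1 h) (conj hI hIT).
exists P; split; last by [].
split; first by split=> // /hPT.
move=> a b hab; apply: NNPP => /not_or_and [na nb].
have key c : ~ P c -> exists t p r, T t /\ P p /\ t = p + r * c.
  move=> nc; apply: NNPP => hn; apply: nc.
  apply: (hmax (addel P c)); last exact: mem_addel.
    split; first exact: ideal_addel.
    by move=> t [p [r [hp et]]] ht; apply: hn; exists t, p, r.
  by move=> x; apply: sub_addel.
have [t [p [r [ht [hp et]]]]] := key a na.
have [t' [p' [r' [ht' [hp' et']]]]] := key b nb.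
apply: (hPT (t * t')); last exact: TM.
have -> : t * t' = (p' + r' * b) * p + r * a * p' + r * r' * (a * b) by rewrite et et'; ring.
by repeat (apply: idealD => //); apply: idealMl.
Qed.

Lemma prime_powers I a : noetherian R -> is_ideal I -> (forall t, ~ I (a ^+ t)) ->
  exists P, prime_ideal P /\ (forall b, I b -> P b) /\ ~ P a.
Proof.
move=> hR hI h; have [|||P [hP [IP hT]]] := @prime_avoid (fun b => exists t, b = a ^+ t) I hR hI.
- by exists 0%N.
- by move=> _ _ [s ->] [t ->]; exists (s + t)%N; rewrite exprD.
- by move=> b hb [t e]; apply: (h t); rewrite -e.
by exists P; split=> //; split=> // /hT; apply; exists 1%N.
Qed.

(** Noetherian induction: if [I] is proper and not prime, some [a b] is in [I] with neither factor
    in it; a prime over [I] contains [a] or [b], so the lists for [I + (a)] and [I + (b)] are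
    concatenated. The primes listed need not be minimal. *)
Lemma prime_list I : noetherian R -> is_ideal I ->
  exists (k : nat) (P : nat -> R -> Prop),
    (forall i, (i < k)%N -> prime_ideal (P i) /\ forall a, I a -> P i a) /\
    forall Q, prime_ideal Q -> (forall a, I a -> Q a) ->
      exists i, (i < k)%N /\ forall a, P i a -> Q a.
Proof.
move=> hR; move: I; apply: noeth_ind => // I hI IH.
have [I1|n1] := classic (I 1).
  exists 0%N, (fun _ _ => True); split=> // Q hQ IQ.
  by case: (prime_n1 hQ); apply: IQ.
have [pI|nP] := classic (prime_ideal I).
  exists 1%N, (fun=> I); split=> [i _|Q hQ IQ]; first by split.
  by exists 0%N.
have [a [b [hab [na nb]]]] : exists a b, I (a * b) /\ ~ I a /\ ~ I b.
  apply: NNPP => hn; apply: nP; split=> // a b hab.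
  by apply: NNPP => /not_or_and [na nb]; apply: hn; exists a, b.
have add c : ~ I c -> exists (k : nat) (P : nat -> R -> Prop),
    (forall i, (i < k)%N -> prime_ideal (P i) /\ forall a, I a -> P i a) /\
    forall Q, prime_ideal Q -> (forall a, I a -> Q a) -> Q c ->
      exists i, (i < k)%N /\ forall a, P i a -> Q a.
  move=> nc; have [||| k [P [h1 h2]]] := IH (addel I c).
  - exact: ideal_addel.
  - by move=> x; apply: sub_addel.
  - by exists c; split=> //; apply: mem_addel.
  exists k, P; split=> [i /h1 [hp hs]|Q hQ IQ Qc]; first by split=> // x /(sub_addel c); apply: hs.
  by apply: h2 => //; apply: addel_sub => //; apply: prime_is_ideal.
have [k [P [hP1 hP2]]] := add a na; have [l [P' [hP1' hP2']]] := add b nb.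
exists (k + l)%N, (fun i => if (i < k)%N then P i else P' (i - k)%N); split=> [i hi|Q hQ IQ].
  case: ltnP => ik; first exact: hP1.
  by apply: hP1'; rewrite ltn_subLR.
case: (hQ) => _ /(_ a b (IQ _ hab)) [Qa|Qb].
  by have [i [ik h]] := hP2 Q hQ IQ Qa; exists i; rewrite ltn_addr // ik.
have [i [ik h]] := hP2' Q hQ IQ Qb; exists (k + i)%N; rewrite ltn_add2l; split=> //.
by rewrite ltnNge leq_addr /= addKn.
Qed.

(* Multiplying by generators until the product would fall into [I]. *)
Lemma socle_elt I F n a : is_ideal I -> ~ I a ->
  (forall i, (i < n)%N -> exists t, I (F i ^+ t)) ->
  exists b, ~ I (b * a) /\ forall i, (i < n)%N -> I (b * a * F i).
Proof.
move=> hI na; elim: n => [|n IH] h; first by exists 1; rewrite mul1r.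
have [b [nb hb]] := IH (fun i hi => h i (ltnW hi)).
have [t ht] := h n (ltnSn n).
have [t' [h1 h2]] : exists t', ~ I (b * a * F n ^+ t') /\ I (b * a * F n ^+ t'.+1).
  have : I (b * a * F n ^+ t) by apply: idealMl.
  elim: t {ht} => [|t IHt]; first by rewrite expr0 mulr1.
  have [/IHt //|n1 h2] := classic (I (b * a * F n ^+ t)).
  by exists t.
exists (b * F n ^+ t'); split=> [|i]; first by rewrite mulrAC.
rewrite ltnS leq_eqVlt => /orP[/eqP ->|/hb hi].
  by have <- : b * a * F n ^+ t'.+1 = b * F n ^+ t' * a * F n by rewrite exprSr; ring.
have -> : b * F n ^+ t' * a * F i = F n ^+ t' * (b * a * F i) by ring.
exact: idealMl.
Qed.

End Ideals.
#[export] Hint Resolve ideal_idl : core.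

(** * Nakayama's lemma and the principal ideal theorem *)

Section Krull.
Variable R : comNzRingType.
Implicit Types (I J P Q : R -> Prop) (F G : nat -> R).

Lemma det_mod I n (A B : 'M[R]_n) : is_ideal I -> (forall i j, I (A i j - B i j)) ->
  I (\det A - \det B).
Proof.
move=> hI h; rewrite /determinant.
apply: (@big_ind2 _ _ (fun a b => I (a - b))) => [|a b c d h1 h2|s _].
- by rewrite subr0; apply: ideal0.
- by rewrite opprD addrACA; apply: idealD.
rewrite -mulrBr; apply: idealMl => //.
apply: (@big_ind2 _ _ (fun a b => I (a - b))) => [|a b c d h1 h2|i _ //].
  by rewrite subrr; apply: ideal0.
have -> : a * c - b * d = c * (a - b) + b * (c - d) by ring.
by apply: idealD => //; apply: idealMl.
Qed.

(* The determinant trick, with multipliers outside [P] instead of a localization. *)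
Lemma nakayama (V : lmodType R) (B : V -> Prop) P t (w : 'I_t -> V) :
  prime_ideal P -> B 0 -> (forall u v, B u -> B v -> B (u + v)) ->
  (forall r u, B u -> B (r *: u)) ->
  (forall i, exists s b (d : 'I_t -> R),
     [/\ ~ P s, B b, forall j, P (d j) & s *: w i = b + \sum_j d j *: w j]) ->
  exists s, ~ P s /\ forall i, B (s *: w i).
Proof.
move=> hP B0 BD BZ h.
have [s {}h] := fin_all_exists h; have [b {}h] := fin_all_exists h.
have [d {}h] := fin_all_exists h.
pose A : 'M[R]_t := diag_mx (\row_i s i) - \matrix_(i, j) d i j.
exists (\det A); split.
  move=> hdet; have : P (\det (diag_mx (\row_i s i))).
    apply: (idealBr (prime_is_ideal hP) _ hdet); apply: det_mod; first exact: prime_is_ideal.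
    move=> i j; rewrite !mxE opprB addrC subrK.
    by case: (h i).
  rewrite det_diag; apply: primeN_prod => // i; rewrite mxE.
  by case: (h i).
move=> k.
have -> : \det A *: w k = \sum_i (\adj A) k i *: b i.
  have hb i : b i = \sum_j A i j *: w j.
    case: (h i) => _ _ _ e; apply: (addIr (\sum_j d i j *: w j)); rewrite -e -big_split /=.
    rewrite (bigD1 i) //= big1 ?addr0 => [|j ij]; rewrite /A !mxE.
      by rewrite eqxx mulr1n scalerBl subrK.
    by rewrite eq_sym (negPf ij) mulr0n add0r scaleNr addNr.
  transitivity (\sum_i \sum_j ((\adj A) k i * A i j) *: w j); last first.
    by apply: eq_bigr => i _; rewrite hb scaler_sumr; apply: eq_bigr => j _; rewrite scalerA.
  rewrite exchange_big /=.
  have e j : \sum_i ((\adj A) k i * A i j) *: w j = ((\det A)%:M) k j *: w j.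
    by rewrite -mul_adj_mx mxE scaler_suml.
  rewrite (eq_bigr _ (fun j _ => e j)) (bigD1 k) //= big1 ?addr0 => [|j jk].
    by rewrite mxE eqxx mulr1n.
  by rewrite mxE eq_sym (negPf jk) scale0r.
elim/big_ind: _ => // i _; apply: BZ; by case: (h i).
Qed.

Section HeightOne.
Variables (P Q Q' : R -> Prop) (f : R).
Hypotheses (hR : noetherian R) (hP : prime_ideal P) (hQ : prime_ideal Q) (hQ' : prime_ideal Q').
Hypotheses (Q'Q : forall a, Q' a -> Q a) (QP : forall a, Q a -> P a) (nPQ : exists a, P a /\ ~ Q a).
Hypotheses (Pf : P f).
Hypothesis Pmin : forall P1, prime_ideal P1 -> (forall a, Q' a -> P1 a) ->
  (forall a, P1 a -> P a) -> P1 f -> forall a, P a -> P1 a.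

(** [satP I] is the contraction to [R] of the extension of [I] to the localization at [P], and
    [issat] singles out the contracted ideals; the local ring itself is never built. *)
Let satP I := fun y => exists s, ~ P s /\ I (s * y).
Let issat I := forall s y, ~ P s -> I (s * y) -> I y.

Let ideal_satP I : is_ideal I -> is_ideal (satP I).
Proof.
move=> hI; split; first by exists 1; rewrite mulr0; split; [apply: prime_n1|apply: ideal0].
split=> [a b [s [ns ha]] [t [nt hb]]|r a [s [ns ha]]].
  exists (s * t); split; first exact: primeNM.
  have -> : s * t * (a + b) = t * (s * a) + s * (t * b) by ring.
  by apply: idealD => //; apply: idealMl.
by exists s; rewrite mulrCA; split=> //; apply: idealMl.
Qed.
Let satP_sat I : issat (satP I).
Proof. by move=> s y ns [t [nt h]]; exists (t * s); rewrite -mulrA; split=> //; apply: primeNM. Qed.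
Let satP_sub I a : I a -> satP I a.
Proof. by exists 1; rewrite mul1r; split=> //; apply: prime_n1. Qed.

Let I0 := satP (addel Q' f).
Let iQ' := prime_is_ideal hQ'.

(** In the localization at [P], the prime [P] is the only one over [Q' + (f)], so its elements are
    nilpotent modulo that ideal. *)
Let I0_pow y : P y -> exists t, I0 (y ^+ t).
Proof.
move=> Py; apply: NNPP => hn.
have iI0 : is_ideal I0 by apply/ideal_satP/ideal_addel.
have [|||P1 [hP1 [h1 h2]]] := @prime_avoid R
  (fun b => exists t s, ~ P s /\ b = s * y ^+ t) I0 hR iI0.
- by exists 0%N, 1; rewrite mulr1; split=> //; apply: prime_n1.
- move=> _ _ [t [s [ns ->]]] [t' [s' [ns' ->]]]; exists (t + t')%N, (s * s').
  by split; [apply: primeNM|rewrite exprD; ring].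
- by move=> a ha [t [s [ns ea]]]; apply: hn; exists t; apply: (@satP_sat _ s) => //; rewrite -ea.
have P1P a : P1 a -> P a.
  by move=> P1a; apply: NNPP => nPa; apply: (h2 a P1a); exists 0%N, a; rewrite mulr1.
apply: (h2 y); last by exists 1%N, 1; rewrite mul1r; split=> //; apply: prime_n1.
by apply: Pmin => // [a Qa|]; apply/h1/satP_sub; [apply: sub_addel|apply: mem_addel].
Qed.

Let stable (J : nat -> R -> Prop) :=
  exists n0, forall n, (n0 <= n)%N -> forall a, J n a -> J n.+1 a.
Let descending (J : nat -> R -> Prop) :=
  forall n, [/\ is_ideal (J n), issat (J n) & forall a, J n.+1 a -> J n a].

(** This stands for the finite length of the local ring modulo [I0]. By noetherian induction on [I]:
    a socle element [z] has [P z] inside [I], and the chain is compared with the chain of its sums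
    with [z], which is stable by induction. *)
Let dcc I : is_ideal I -> issat I -> (forall a, I0 a -> I a) ->
  forall J : nat -> R -> Prop, descending J -> (forall n a, I a -> J n a) -> stable J.
Proof.
move=> iI sI I0I.
move: I iI sI I0I; apply: noeth_ind => // I iI IH sI I0I J hJ IJ.
have [I1|n1] := classic (I 1).
  by exists 0%N => n _ a _; rewrite -(mulr1 a); apply: idealMl; [case: (hJ n.+1)|apply: IJ].
have [k [p hp]] := noeth_fg hR (prime_is_ideal hP).
have [|z [nz hz]] := @socle_elt R I p k 1 iI n1.
  move=> i hi; have [|t ht] := @I0_pow (p i); first by apply/hp/mem_idl.
  by exists t; apply: I0I.
move: nz hz; rewrite mulr1 => nz hz.
have Pz r : P r -> I (r * z).
  move/hp => [c ->]; rewrite mulr_suml; apply: ideal_sum => // i _.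
  by rewrite -mulrA (mulrC _ z); apply: idealMl => //; apply: hz.
have st : forall J' : nat -> R -> Prop, descending J' -> (forall n a, satP (addel I z) a -> J' n a) -> stable J'.
  apply: IH.
  - exact/ideal_satP/ideal_addel.
  - by move=> a Ia; apply/satP_sub/sub_addel.
  - by exists z; split=> //; apply/satP_sub/mem_addel.
  - exact: satP_sat.
  - by move=> a /I0I Ia; apply/satP_sub/sub_addel.
have [Jz|] := classic (forall n, J n z).
  apply: (st J) => // n a [s [ns [b [r [Ib e]]]]]; have [i1 s1 _] := hJ n.
  apply: (s1 s) => //; rewrite e; apply: idealD => //; first exact: IJ.
  exact: idealMl.
move/not_all_ex_not => [n1' nz1].
have anti m n a : (m <= n)%N -> J n a -> J m a.
  elim: n => [|n IHn]; first by rewrite leqn0 => /eqP ->.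
  by rewrite leq_eqVlt => /orP[/eqP -> //|mn] Ja; apply: IHn => //; case: (hJ n) => _ _; apply.
have [||n0 h0] := st (fun n => satP (addel (J n) z)).
- move=> n; have [i1 s1 d1] := hJ n; split.
  + exact/ideal_satP/ideal_addel.
  + exact: satP_sat.
  + move=> a [s [ns [b [r [Jb e]]]]]; exists s; split=> //; exists b, r; split=> //; exact: d1.
- move=> n a [s [ns [b [r [Ib e]]]]]; exists s; split=> //; exists b, r; split=> //; exact: IJ.
exists (maxn n0 n1') => n; rewrite geq_max => /andP[n0n n1n] y Jy.
have [i1 s1 d1] := hJ n; have [i2 s2 d2] := hJ n.+1.
(* In [s y = y' + r z] the term [r z] lies in [J n]; since [z] does not, saturation forces [r] into
   [P], hence [r z] into [I]. *)
have [s [ns [y' [r [Jy' e]]]]] : satP (addel (J n.+1) z) y.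
  by apply: (h0 n n0n); apply/satP_sub/sub_addel.
apply: (s2 s) => //; rewrite e; apply: idealD => //; apply: IJ; apply: Pz.
apply: NNPP => nPr; apply: nz1; apply: (anti _ n) => //; apply: (s1 r) => //.
have -> : r * z = s * y - y' by rewrite e; ring.
by apply: idealB => //; [apply: idealMl|apply: d1].
Qed.

(* [Qp n] is [Q^n + Q'], for [Q] generated by the first [k] terms of [q], and
   [Sn n] is the corresponding symbolic power. *)
Lemma height_one : forall a, Q a -> Q' a.
Proof.
have iQ := prime_is_ideal hQ.
have nQf : ~ Q f.
  move=> Qf; case: nPQ => a [Pa]; apply.
  exact: (Pmin hQ).
have [k [q hq]] := noeth_fg hR iQ.
pose Qp := fix Qp (n : nat) : R -> Prop := if n is m.+1 then
   fun y => exists (c : nat -> R) e, [/\ forall i, Qp m (c i), Q' e & y = \sum_(i < k) c i * q i + e]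
  else fun=> True.
have iQp n : is_ideal (Qp n).
  elim: n => [//|n IHn]; split.
    exists (fun=> 0), 0; split; rewrite ?big1 ?addr0 // => *; rewrite ?mul0r //; exact: ideal0.
  split=> [_ _ [c [e [hc he ->]]] [c' [e' [hc' he' ->]]]|r _ [c [e [hc he ->]]]].
    exists (fun i => c i + c' i), (e + e'); split; [by move=> i; apply: (idealD IHn (hc i) (hc' i))|exact: idealD|].
    by rewrite addrACA -big_split; congr (_ + _); apply: eq_bigr => i _ /=; rewrite mulrDl.
  exists (fun i => r * c i), (r * e); split; [by move=> i; apply: (idealMl r IHn (hc i))|exact: idealMl|].
  by rewrite mulrDr mulr_sumr; congr (_ + _); apply: eq_bigr => i _; rewrite mulrA.
have Qp_desc n a : Qp n.+1 a -> Qp n a.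
  elim: n a => [//|n IHn] _ [c [e [hc he ->]]]; exists c, e; split=> // i; exact: IHn.
have Qp_Q' n a : Q' a -> Qp n a.
  case: n => [//|n] Qa; exists (fun=> 0), a; split=> // [i|]; first exact: ideal0.
  by rewrite big1 ?add0r // => i _; rewrite mul0r.
have Qp_pow a n : Q a -> Qp n (a ^+ n).
  move=> Qa; elim: n => [//|n IHn]; have [d ed] := proj1 (hq a) Qa.
  exists (fun i => d i * a ^+ n), 0; split; [by move=> i; apply: idealMl|exact: ideal0|].
  rewrite addr0 exprSr {2}ed mulr_sumr; apply: eq_bigr => i _; by rewrite mulrCA mulrA.
pose Sn n y := exists s, ~ Q s /\ Qp n (s * y).
have iS n : is_ideal (Sn n).
  split; first by exists 1; rewrite mulr0; split; [apply: prime_n1|apply: ideal0].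
  split=> [a b [s [ns ha]] [t [nt hb]]|r a [s [ns ha]]].
    exists (s * t); split; first exact: primeNM.
    have -> : s * t * (a + b) = t * (s * a) + s * (t * b) by ring.
    by apply: idealD => //; apply: idealMl.
  by exists s; rewrite mulrCA; split=> //; apply: idealMl.
have sS n s y : ~ Q s -> Sn n (s * y) -> Sn n y.
  by move=> ns [t [nt h]]; exists (t * s); rewrite -mulrA; split=> //; apply: primeNM.
have Sn_desc n a : Sn n.+1 a -> Sn n a by move=> [s [ns /Qp_desc h]]; exists s.
have Sn_Qp n a : Qp n a -> Sn n a by exists 1; rewrite mul1r; split=> //; apply: prime_n1.
have nPnQ s : ~ P s -> ~ Q s by move=> nP /QP.
have iI0 : is_ideal I0 by apply/ideal_satP/ideal_addel.
have [||n hn] := @dcc I0 iI0 (@satP_sat _) (fun _ h => h) (fun n => satP (addel (Sn n) f)).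
- move=> n; split; [exact/ideal_satP/ideal_addel|exact: satP_sat|].
  by move=> a [s [ns [b [r [hb e]]]]]; exists s; split=> //; exists b, r; split=> //; apply: Sn_desc.
- move=> n a [s [ns [b [r [hb e]]]]]; exists s; split=> //; exists b, r; split=> //.
  exact/Sn_Qp/Qp_Q'.
have {}hn := hn n (leqnn n).
(* Stability gives [s w = b + f c] with [b] in [Sn n.+1]. Then [f c] is in [Sn n] and [f] is outside
   [Q], so [c] is in [Sn n]; as [f] is in [P], Nakayama at [P] absorbs this term. *)
have Sn_stable a : Sn n a -> Sn n.+1 a.
  have [t [w hw]] := noeth_fg hR (iS n).
  have Snw i : (i < t)%N -> Sn n (w i) by move=> hi; apply/hw/mem_idl.
  have [||||s [ns hs]] := @nakayama R^o (Sn n.+1) P t (fun i => w i) hP.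
  - exact: (ideal0 (iS n.+1)).
  - by move=> u v; apply: (idealD (iS n.+1)).
  - by move=> r u; apply: (idealMl r (iS n.+1)).
  - move=> i; have [|s [ns [b [c [hb e]]]]] := hn (w i).
      exact/satP_sub/sub_addel/Snw.
    have /hw [d ed] : Sn n c.
      apply: (sS _ f) => //; have -> : f * c = s * w i - b by rewrite e; ring.
      exact: (idealB (iS n) (idealMl s (iS n) (Snw i (ltn_ord i))) (Sn_desc _ _ hb)).
    exists s, b, (fun j => f * d j); split=> // [j|].
      exact: (idealMr _ (prime_is_ideal hP) Pf).
    rewrite /GRing.scale /= e ed mulr_suml; congr (_ + _); apply: eq_bigr => j _.
    by rewrite mulrC mulrA.
  move/hw => [c ->]; apply: ideal_sum => // i _; apply: idealMl => //.
  by apply: (sS _ s); [apply: nPnQ|apply: hs].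
have [t [w hw]] := noeth_fg hR (iQp n).
(* Localized at [Q] and modulo [Q'], the powers of exponents [n] and [n + 1] now agree; a second use
   of Nakayama, at [Q], gives one [s] outside [Q] sending all of [Q^n] into [Q']. *)
have [||||s [ns hs]] := @nakayama R^o Q' Q t (fun i => w i) hQ.
- exact: (ideal0 iQ').
- by move=> u v; apply: (idealD iQ').
- by move=> r u; apply: (idealMl r iQ').
- move=> i; have [s [ns [c [e [hc he ee]]]]] : Sn n.+1 (w i).
    by apply/Sn_stable/Sn_Qp/hw/mem_idl.
  have /fin_all_exists [d hd] : forall j : 'I_k, exists d : nat -> R, c j = \sum_(l < t) d l * w l.
    by move=> j; apply/hw/hc.
  exists s, e, (fun l => \sum_(j < k) q j * d j l); split=> // [l|].
    apply: (ideal_sum _ iQ) => j _; apply: (idealMr _ iQ).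
    by apply/hq/mem_idl.
  rewrite /GRing.scale /= ee addrC; congr (_ + _).
  transitivity (\sum_(j < k) \sum_(l < t) q j * d j l * w l).
    apply: eq_bigr => j _; rewrite hd mulr_suml; apply: eq_bigr => l _; ring.
  by rewrite exchange_big; apply: eq_bigr => l _; rewrite mulr_suml.
move=> a Qa; have /hw [c ec] := Qp_pow a n Qa.
have : Q' (s * a ^+ n).
  by rewrite ec mulr_sumr; apply: ideal_sum => // i _; rewrite mulrCA; apply: idealMl => //; apply: hs.
by case: (hQ') => _ h /h [/Q'Q //|/(primeX hQ')].
Qed.

End HeightOne.
End Krull.

(** * Height, local rings and prime avoidance *)

Section Height.
Variable R : comNzRingType.
Hypothesis hR : noetherian R.
Implicit Types (I J P Q M m : R -> Prop) (F G : nat -> R).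

Lemma prime_chain_mono k (C : nat -> R -> Prop) i j a : prime_chain k C ->
  (i <= j)%N -> (j <= k)%N -> C i a -> C j a.
Proof.
move=> [_ Cs]; elim: j => [|j IH]; first by rewrite leqn0 => /eqP ->.
rewrite leq_eqVlt => /orP[/eqP -> //|ij] jk Ca.
by have [h _] := Cs j jk; apply/h/IH => //; apply: ltnW.
Qed.

Definition minimal_over P F r :=
  (forall i, (i < r)%N -> P (F i)) /\
  forall P1, prime_ideal P1 -> (forall i, (i < r)%N -> P1 (F i)) ->
    (forall a, P1 a -> P a) -> forall a, P a -> P1 a.

Lemma minimal_over_pow P I y : prime_ideal P -> is_ideal I ->
  (forall P1, prime_ideal P1 -> (forall a, I a -> P1 a) ->
     (forall a, P1 a -> P a) -> forall a, P a -> P1 a) ->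
  P y -> exists s t, ~ P s /\ I (s * y ^+ t).
Proof.
move=> hP hI Pmin Py; apply: NNPP => hn.
have [|||P1 [hP1 [h1 h2]]] := @prime_avoid R
  (fun b => exists s t, ~ P s /\ b = s * y ^+ t) I hR hI.
- by exists 1, 0%N; rewrite mulr1; split=> //; apply: prime_n1.
- move=> _ _ [s [t [ns ->]]] [s' [t' [ns' ->]]]; exists (s * s'), (t + t')%N.
  by split; [apply: primeNM|rewrite exprD; ring].
- by move=> a ha [s [t [ns ea]]]; apply: hn; exists s, t; rewrite -ea.
have P1P a : P1 a -> P a.
  by move=> P1a; apply: NNPP => nPa; apply: (h2 a P1a); exists a, 0%N; rewrite mulr1.
apply: (h2 y); last by exists 1, 1%N; rewrite mul1r; split=> //; apply: prime_n1.
exact: (Pmin P1).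
Qed.

(** Induction on [r]. Take [Q] maximal among the primes strictly below [P] that contain the last
    chain term but one, and [F j] outside [Q]. Then [P] is minimal over [Q + (F j)], so up to
    multipliers outside [P] a power of each [F i] is some [p i] in [Q] modulo [F j]. By
    [height_one], [Q] is minimal over the [p i] with [i] other than [j], which are one fewer. *)
Lemma krull_height r k P F (C : nat -> R -> Prop) :
  prime_ideal P -> minimal_over P F r -> prime_chain k C -> (forall a, C k a -> P a) -> (k <= r)%N.
Proof.
elim: r k P F => [|r IH] k P F hP [PF Pmin] hC CP; case: k hC CP => // k hC CP; have [Cp Cs] := hC.
  have [_ []] := Cs 0%N isT; move=> a C1a; apply: (Pmin (C 0%N)) => //; first exact: Cp.
    by move=> b C0b; apply/CP/(prime_chain_mono hC _ _ C0b).
  by apply/CP/(prime_chain_mono hC _ _ C1a).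
have [kC /not_sub [a0 [Ca0 na0]]] := Cs k (ltnSn k).
have kP : exists a, P a /\ ~ C k a by exists a0; split=> //; apply: CP.
have [Q [[hQ [QP nPQ]] [CQ Qmax]]] := @noeth_max R
  (fun Q => prime_ideal Q /\ (forall a, Q a -> P a) /\ exists a, P a /\ ~ Q a) (C k) hR
  (fun Q h => prime_is_ideal (proj1 h)) (conj (Cp k (leqnSn k)) (conj (fun a h => CP a (kC a h)) kP)).
have [j [jr nQj]] : exists j, (j < r.+1)%N /\ ~ Q (F j).
  apply: NNPP => hn; case: nPQ => a [Pa]; apply; apply: (Pmin Q) => // i hi.
  by apply: NNPP => nQ; apply: hn; exists i.
have iQ := prime_is_ideal hQ.
have Pj : P (F j) by apply: PF.
have hadd i : (i < r.+1)%N -> exists p, [/\ Q p & exists s t c, ~ P s /\ s * F i ^+ t = p + c * F j].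
  move=> hi.
  have [||s [t [ns [p [c [hp e]]]]]] := @minimal_over_pow P (addel Q (F j)) (F i) hP (ideal_addel (F j) iQ).
  - move=> P1 hP1 h1 P1P a Pa; apply: NNPP => nP1.
    apply: nQj; apply: (Qmax P1); last exact/h1/mem_addel.
      by split=> //; split=> //; exists a.
    by move=> b Qb; apply/h1/sub_addel.
  - exact: PF.
  by exists p; split=> //; exists s, t, c.
have [p hp] : exists p : nat -> R, forall i, (i < r.+1)%N ->
    [/\ Q (p i) & exists s t c, ~ P s /\ s * F i ^+ t = p i + c * F j].
  have /fin_all_exists [p hp] : forall i : 'I_r.+1, exists p,
     [/\ Q p & exists s t c, ~ P s /\ s * F i ^+ t = p + c * F j] by move=> i; apply: hadd.
  exists (ext p) => i hi; have := hp (Ordinal hi); by rewrite -{1 2}(extE p).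
pose u i := p (bump j i).
have hbump i : (i < r)%N -> (bump j i < r.+1)%N.
  by move=> hi; rewrite /bump; case: (j <= i)%N; rewrite ?add1n ?add0n // ltnW.
have minQ : minimal_over Q u r.
  split=> [i /hbump /hp [] //|Q1 hQ1 Q1u Q1Q].
  apply: (height_one hR hP hQ hQ1 Q1Q QP nPQ Pj) => P1 hP1 Q1P1 P1P P1j.
  apply: Pmin => // i hi; case: (eqVneq i j) => [-> //|ij].
  have [_ [s [t [c [ns e]]]]] := hp i hi.
  have : P1 (s * F i ^+ t).
    rewrite e; apply: idealD; [exact: prime_is_ideal| |by apply: idealMl => //; exact: prime_is_ideal].
    have -> : p i = u (unbump j i) by rewrite /u unbumpKcond (negPf ij).
    apply/Q1P1/Q1u; rewrite /unbump; move: hi ij jr; case: (ltngtP j i) => //= hij hi _ jr.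
      by rewrite subn1 -ltnS prednK // (leq_trans _ hij).
    by rewrite subn0; apply: leq_trans hij _.
  by case: (hP1) => _ h /h [/P1P //|/(primeX hP1)].
rewrite ltnS; apply: (IH k Q u hQ minQ) => //.
by split=> i hi; [apply: Cp; apply: leqW|apply: Cs; apply: leqW].
Qed.

Lemma maximal_prime M : maximal_ideal M -> prime_ideal M.
Proof.
move=> [[hM n1] hmax]; split=> // a b hab.
apply: NNPP => /not_or_and [na nb].
have [|h|] := hmax (addel M a) (ideal_addel a hM); first by move=> x; apply: sub_addel.
  by apply: na; apply/h/mem_addel.
move=> [p [r [hp e]]]; apply: nb; have -> : b = b * p + r * (a * b).
  by rewrite -{1}(mulr1 b) e; ring.
by apply: idealD => //; apply: idealMl.
Qed.

Lemma maximal_exists I : is_ideal I -> ~ I 1 -> exists M, maximal_ideal M /\ forall a, I a -> M a.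
Proof.
move=> hI n1; have [M [[hM nM] [IM hmax]]] := @noeth_max R
  (fun I => is_ideal I /\ ~ I 1) I hR (fun I h => proj1 h) (conj hI n1).
exists M; split=> //; split=> // J hJ MJ.
have [|nJ] := classic (J 1); [by right|left=> a; split; [|exact: MJ]].
by apply: hmax.
Qed.

Lemma local_proper M I a : local_with_max M -> is_ideal I -> ~ I 1 -> I a -> M a.
Proof.
move=> [_ hu] hI n1 Ia; have [N [hN IN]] := maximal_exists hI n1.
by apply/(hu N hN)/IN.
Qed.

Lemma local_unit M a : local_with_max M -> ~ M a -> exists b, b * a = 1.
Proof.
move=> hM na; apply: NNPP => hn; apply: na.
apply: (@local_proper M (addel (fun b => b = 0) a)) => //.
- apply: ideal_addel; split=> //; split=> [b c -> ->|r b ->]; [exact: addr0|exact: mulr0].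
- by move=> [p [r [-> e]]]; apply: hn; exists r; rewrite e add0r.
- exists 0, 1; by rewrite mul1r add0r.
Qed.

Lemma local_prime M : local_with_max M -> prime_ideal M.
Proof. by case=> /maximal_prime. Qed.

(* [I] contains a power of [m], stated elementwise. *)
Definition mprim (m I : R -> Prop) := forall a, m a -> exists t, I (a ^+ t).

Lemma mprim_sub m I J : (forall a, I a -> J a) -> mprim m I -> mprim m J.
Proof. by move=> h hI a /hI [t /h]; exists t. Qed.

(** A prime over [Q] other than [m] misses [u], and by [height_one] two such primes are never
    strictly nested ([incomp]). So [g + s u] has only to miss the finitely many listed primes other
    than [m], and [s] is corrected one prime at a time. *)
Lemma local_avoid m Q u g : local_with_max m -> is_ideal Q -> m u ->
  mprim m (addel Q u) -> exists s, mprim m (addel Q (g + s * u)).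
Proof.
move=> hm iQ mu hu.
have pm := local_prime hm.
have sub_m P a : prime_ideal P -> P a -> m a.
  by move=> hP; apply: local_proper (prime_is_ideal hP) (prime_n1 hP).
have u_sub P : prime_ideal P -> (forall a, Q a -> P a) -> P u -> forall a, m a -> P a.
  move=> hP QP Pu a /hu [t ht]; apply: (@primeX _ P a t) => //.
  by move: ht; apply: addel_sub => //; apply: prime_is_ideal.
have incomp P1 P : prime_ideal P1 -> prime_ideal P -> (forall a, Q a -> P1 a) ->
    (forall a, P1 a -> P a) -> ~ (forall a, m a -> P a) -> forall a, P a -> P1 a.
  move=> hP1 hP QP1 P1P nP.
  apply: (@height_one R m P P1 u) => //.
  - by move=> a; apply: sub_m.
  - exact: not_sub.
  - by move=> P2 hP2 P1P2 _ P2u; apply: u_sub => // a /QP1; apply: P1P2.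
have [k [P [hP hPQ]]] := prime_list hR iQ.
pose bad i := ~ (forall a, m a -> P i a).
have [s hs] : exists s, forall i, (i < k)%N -> bad i -> ~ P i (g + s * u).
  have : forall i, (i < k)%N -> prime_ideal (P i) /\ forall a, Q a -> P i a by [].
  elim: k {hP hPQ} => [|k IH] hP; first by exists 0.
  have [s hs] := IH (fun i hi => hP i (ltnW hi)).
  have [[badk Pk]|nk] := classic (bad k /\ P k (g + s * u)); last first.
    exists s => i; rewrite ltnS leq_eqVlt => /orP[/eqP ->|/hs //] bk Pk.
    by apply: nk.
  have [pk Qk] := hP k (ltnSn k).
  (* The product of these [p i] is added to [s]: it lies in every earlier bad prime, where the
     residue of [g + s u] is kept, and outside [P k], where that residue was zero. *)
  have /fin_all_exists [p hp] : forall i : 'I_k, exists p, (bad i -> P i p) /\ ~ P k p.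
    move=> i; have [bi|nb] := classic (bad i); last by exists 1; split=> //; apply: prime_n1.
    have [pi Qi] := hP i (ltnW (ltn_ord i)).
    have : ~ (forall a, P i a -> P k a).
      by move=> h; apply: (hs i _ bi) => //; apply: (incomp (P i) (P k)).
    by move/not_sub => [a [Pa na]]; exists a.
  exists (s + \prod_i p i) => i.
  have -> : g + (s + \prod_i p i) * u = (g + s * u) + u * \prod_i p i by ring.
  rewrite ltnS leq_eqVlt => /orP[/eqP -> _ h|ik bi h].
    have : P k (u * \prod_i p i).
      have -> : u * \prod_i p i = (g + s * u) + u * \prod_i p i - (g + s * u) by ring.
      by apply: idealB => //; apply: prime_is_ideal.
    apply: primeNM => //; first by move=> Pu; apply: badk; apply: u_sub.
    by apply: primeN_prod => // j; case: (hp j).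
  have [pi Qi] := hP i (ltnW ik); have iP := prime_is_ideal pi.
  apply: (hs i ik bi).
  have -> : g + s * u = (g + s * u) + u * \prod_i p i - u * \prod_i p i by ring.
  apply: idealB => //; apply: idealMl => //; rewrite (bigD1 (Ordinal ik)) //=.
  by apply: (idealMr _ iP); case: (hp (Ordinal ik)) => + _; apply.
exists s => a ma; apply: NNPP => hn.
have [|P1 [hP1 [h1 nP1]]] := @prime_powers R (addel Q (g + s * u)) a hR (ideal_addel _ iQ).
  by move=> t ht; apply: hn; exists t.
have QP1 b : Q b -> P1 b by move=> Qb; apply/h1/sub_addel.
have [i [ik PiP1]] := hPQ P1 hP1 QP1.
have [pi Qi] := hP i ik.
apply: (hs i ik); first by move=> h; apply: nP1; apply/PiP1/h.
apply: (incomp (P i) P1) => //; first by move=> h; apply: nP1; apply: h.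
exact/h1/mem_addel.
Qed.

Lemma local_avoid_seq m d F G : local_with_max m -> (forall i, (i < d)%N -> m (F i)) ->
  mprim m (idl F d) -> exists s : nat -> R, mprim m (idl (fun i => G i + s i * F i) d).
Proof.
move=> hm mF hF.
have key k : (k <= d)%N -> exists s : nat -> R,
    mprim m (idl (fun i => if (i < k)%N then G i + s i * F i else F i) d).
  elim: k => [|k IH] kd; first by exists (fun=> 0).
  have [s] := IH (ltnW kd); set H := fun i : nat => _ => hH.
  (* A zero in place [k] removes that generator without changing the length [d]. *)
  pose Hz i := if i == k then 0 else H i.
  have [||s' hs'] := @local_avoid m (idl Hz d) (F k) (G k) hm (ideal_idl Hz d).
  - exact: mF.
  - apply: mprim_sub hH; apply: idl_sub; first exact: ideal_addel.
    move=> i hi; case: (eqVneq i k) => [->|ik].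
      by rewrite /H ltnn; apply: mem_addel.
    apply: sub_addel; have -> : H i = Hz i by rewrite /Hz (negPf ik).
    exact: mem_idl.
  exists (fun i => if i == k then s' else s i).
  set H' := fun i : nat => _.
  apply: mprim_sub hs' => a; apply: addel_sub => //.
    apply: idl_sub => // i hi; rewrite /Hz; case: eqVneq => [_|ik]; first exact: (ideal0 (ideal_idl _ _)).
    have -> : H i = H' i by rewrite /H /H' ltnS (leq_eqVlt i k) (negPf ik).
    exact: mem_idl.
  have -> : G k + s' * F k = H' k by rewrite /H' ltnSn eqxx.
  exact: mem_idl.
have [s hs] := key d (leqnn d); exists s.
apply: mprim_sub hs; apply: idl_sub => // i hi; rewrite hi.
exact: (@mem_idl _ (fun i => G i + s i * F i)).
Qed.

End Height.

(** * The Koszul complex *)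

Section Koszul.
Variable R : comNzRingType.
Implicit Types (I J P Q M m : R -> Prop) (F G f : nat -> R).

(* The Koszul complex on [e_0, ..., e_(n-1)], all degrees together: the pair [(u, v)] stands
   for [u + e_n /\ v], [bd F] is the boundary with [e_i |-> F i], and [wd c] is the wedge product
   with the sum of the [c i e_i] on the left. *)
Fixpoint Kz (n : nat) : lmodType R := if n is n'.+1 then (Kz n' * Kz n')%type else R^o.

Fixpoint bd F n : Kz n -> Kz n :=
  if n is n'.+1 then fun u => (bd F u.1 + F n' *: u.2, - bd F u.2) else fun=> 0.
Fixpoint wd (c : nat -> R) n : Kz n -> Kz n :=
  if n is n'.+1 then fun u => (wd c u.1, c n' *: u.1 - wd c u.2) else fun=> 0.
Fixpoint deg n : nat -> Kz n -> Prop :=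
  if n is n'.+1 then fun i u => deg i u.1 /\ (if i is i'.+1 then deg i' u.2 else u.2 = 0)
  else fun i u => if i is _.+1 then u = 0 else True.
Fixpoint inK I n : Kz n -> Prop :=
  if n is n'.+1 then fun u => inK I u.1 /\ inK I u.2 else fun u : R => I u.
Fixpoint oneK n : Kz n := if n is n'.+1 then (oneK n', 0) else (1 : R).
Fixpoint topK n : Kz n := if n is n'.+1 then (0, topK n') else (1 : R).
Fixpoint lastK n : Kz n -> R := if n is n'.+1 then fun u => lastK u.2 else fun u : R => u.

Lemma bdD F n u v : bd F (u + v : Kz n) = bd F u + bd F v.
Proof.
elim: n u v => [|n IH] u v /=; first by rewrite addr0.
by rewrite !IH scalerDr addrACA opprD.
Qed.
Lemma bdZ F n a u : bd F (a *: u : Kz n) = a *: bd F u.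
Proof.
elim: n u => [|n IH] u /=; first by rewrite scaler0.
rewrite !IH; congr pair => /=; rewrite ?(scalerDr, scalerN, scalerA) //. rewrite (mulrC a); congr (_ + _).
Qed.
Lemma bdN F n u : bd F (- u : Kz n) = - bd F u.
Proof. by rewrite -scaleN1r bdZ scaleN1r. Qed.
Lemma wdD c n u v : wd c (u + v : Kz n) = wd c u + wd c v.
Proof.
elim: n u v => [|n IH] u v /=; first by rewrite addr0.
by rewrite !IH scalerDr opprD addrACA.
Qed.
Lemma wdZ c n a u : wd c (a *: u : Kz n) = a *: wd c u.
Proof.
elim: n u => [|n IH] u /=; first by rewrite scaler0.
by rewrite !IH; congr pair => /=; rewrite ?(scalerDr, scalerN, scalerA) // (mulrC a); congr (_ - _).
Qed.
Lemma wdN c n u : wd c (- u : Kz n) = - wd c u.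
Proof. by rewrite -scaleN1r wdZ scaleN1r. Qed.
Lemma bd0 F n : bd F (0 : Kz n) = 0.
Proof. by have := bdZ F 0 (0 : Kz n); rewrite !scale0r. Qed.
Lemma wd0 c n : wd c (0 : Kz n) = 0.
Proof. by have := wdZ c 0 (0 : Kz n); rewrite !scale0r. Qed.
Lemma bd_bd F n (u : Kz n) : bd F (bd F u) = 0.
Proof.
elim: n u => [//|n IH] u /=.
apply: (@f_equal2 _ _ _ (@pair _ _) _ 0 _ 0); last by rewrite bdN IH !oppr0.
by rewrite bdD bdZ IH add0r scalerN subrr.
Qed.
(** [bd] is an antiderivation for the wedge product, so an element of the ideal of the [F i] acts on
    homology as zero, with homotopy [wd c]. *)
Lemma bd_wd F c n (u : Kz n) : bd F (wd c u) = (\sum_(i < n) c i * F i) *: u - wd c (bd F u).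
Proof.
elim: n u => [|n IH] u /=; first by rewrite big_ord0 scale0r subr0.
rewrite big_ord_recr /= !(bdD, bdZ, bdN, IH, wdD, wdZ, wdN); set s := \sum_(i < n) _.
apply: (@f_equal2 _ _ _ (@pair _ _) _ ((s + c n * F n) *: u.1 - (wd c (bd F u.1) + F n *: wd c u.2)) _
  ((s + c n * F n) *: u.2 - (c n *: (bd F u.1 + F n *: u.2) - - wd c (bd F u.2)))).
  by rewrite scalerBr scalerDl opprD scalerA (mulrC (F n)) addrACA.
rewrite opprK opprB scalerDl scalerDr scalerA.
have -> : c n *: bd F u.1 + (c n * F n) *: u.2 + wd c (bd F u.2) =
  (c n * F n) *: u.2 + (wd c (bd F u.2) + c n *: bd F u.1).
  by rewrite addrAC addrC (addrC (c n *: _)).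
by rewrite opprD addrA addrK opprD addrA.
Qed.

Lemma deg0K n i : deg i (0 : Kz n).
Proof. by elim: n i => [|n IH] [|i] //=. Qed.
Lemma degD n i (u v : Kz n) : deg i u -> deg i v -> deg i (u + v).
Proof.
elim: n i u v => [|n IH] [|i] u v //=; first by move=> -> ->; rewrite addr0.
  by move=> [h1 e1] [h2 e2]; split; [apply: IH|rewrite e1 e2 addr0].
by move=> [h1 h2] [h3 h4]; split; apply: IH.
Qed.
Lemma degZ n i a (u : Kz n) : deg i u -> deg i (a *: u).
Proof.
elim: n i u => [|n IH] [|i] u //=; first by move=> ->; rewrite scaler0.
  by move=> [h1 e1]; split; [apply: IH|rewrite e1 scaler0].
by move=> [h1 h2]; split; apply: IH.
Qed.
Lemma degN n i (u : Kz n) : deg i u -> deg i (- u).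
Proof. by rewrite -scaleN1r; apply: degZ. Qed.
Lemma degB n i (u v : Kz n) : deg i u -> deg i v -> deg i (u - v).
Proof. by move=> hu hv; apply: degD => //; apply: degN. Qed.
Lemma deg_big n i (u : Kz n) : (n < i)%N -> deg i u -> u = 0.
Proof.
elim: n i u => [|n IH] [|i] //= [u v] ni [/= h1 h2].
by rewrite (IH _ _ (ltnW ni) h1) (IH _ _ _ h2).
Qed.
Lemma deg_bd0 F n (u : Kz n) : deg 0 u -> bd F u = 0.
Proof.
elim: n u => [//|n IH] [u v] /= [h1 ->].
by rewrite IH // scaler0 addr0 bd0 oppr0.
Qed.
Lemma deg_bd F n i (u : Kz n) : deg i.+1 u -> deg i (bd F u).
Proof.
elim: n i u => [|n IH] i u /=; first by case: i.
case: i => [|i] [h1 h2]; split.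
- by apply: degD; [apply: IH|apply: degZ].
- by rewrite deg_bd0 // oppr0.
- by apply: degD; [apply: IH|apply: degZ].
- by apply: degN; apply: IH.
Qed.
Lemma deg_wd c n i (u : Kz n) : deg i u -> deg i.+1 (wd c u).
Proof.
elim: n i u => [|n IH] [|i] u //= [h1 h2]; split.
- exact: IH.
- have -> : wd c u.2 = 0 by rewrite h2 wd0.
  by rewrite subr0; apply: degZ.
- exact: IH.
- by apply: degB; [apply: degZ|apply: IH].
Qed.
Lemma deg_one n : deg 0 (oneK n). Proof. by elim: n. Qed.
Lemma bd_one F n : bd F (oneK n) = 0. Proof. exact/deg_bd0/deg_one. Qed.
Lemma deg0_one n (u : Kz n) : deg 0 u -> exists a, u = a *: oneK n.
Proof.
elim: n u => [|n IH] u /=; first by exists u; rewrite /GRing.scale /= mulr1.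
case: u => u v /= [/IH [a ->] ->]; exists a.
by apply: (@f_equal2 _ _ _ (@pair _ _)) => //; rewrite scaler0.
Qed.
Lemma one_inj n a b : a *: oneK n = b *: oneK n -> a = b.
Proof.
elim: n => [|n IH] /=; first by rewrite /GRing.scale /= !mulr1.
by case=> /IH.
Qed.
Lemma deg_top n : deg n (topK n).
Proof. by elim: n => [//|n IH] /=; split=> //; apply: deg0K. Qed.
Lemma degn_top n (u : Kz n) : deg n u -> u = lastK u *: topK n.
Proof.
elim: n u => [|n IH] u /=; first by rewrite /GRing.scale /= mulr1.
case: u => u v /= [/(deg_big (ltnSn n)) -> /IH {1}->].
by apply: (@f_equal2 _ _ _ (@pair _ _)) => //; rewrite scaler0.
Qed.
Lemma lastD n (u v : Kz n) : lastK (u + v) = lastK u + lastK v.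
Proof. by elim: n u v => [//|n IH] u v /=. Qed.
Lemma lastZ n a (u : Kz n) : lastK (a *: u) = a * lastK u.
Proof. by elim: n u => [//|n IH] u /=. Qed.
Lemma last_top n : lastK (topK n) = 1. Proof. by elim: n. Qed.

Section InK.
Variables (I : R -> Prop) (hI : is_ideal I).
Lemma inK0 n : inK I (0 : Kz n).
Proof. by elim: n => [|n IH] /=; [apply: (ideal0 hI)|]. Qed.
Lemma inKD n (u v : Kz n) : inK I u -> inK I v -> inK I (u + v).
Proof.
elim: n u v => [|n IH] u v /=; first exact: (idealD hI).
by move=> [h1 h2] [h3 h4]; split; apply: IH.
Qed.
Lemma inKZ n a (u : Kz n) : inK I u -> inK I (a *: u).
Proof.
elim: n u => [|n IH] u /=; first exact: (idealMl _ hI).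
by move=> [h1 h2]; split; apply: IH.
Qed.
Lemma inKZl n a (u : Kz n) : I a -> inK I (a *: u).
Proof.
move=> Ia; elim: n u => [|n IH] u /=; first exact: (idealMr _ hI).
by split; apply: IH.
Qed.
Lemma inKN n (u : Kz n) : inK I u -> inK I (- u).
Proof. by rewrite -scaleN1r; apply: inKZ. Qed.
Lemma inKB n (u v : Kz n) : inK I u -> inK I v -> inK I (u - v).
Proof. by move=> hu hv; apply: inKD => //; apply: inKN. Qed.
Lemma inK_bd F n (u : Kz n) : inK I u -> inK I (bd F u).
Proof.
elim: n u => [|n IH] u /=; first by move=> _; apply: (ideal0 hI).
move=> [h1 h2]; split; last by apply: inKN; apply: IH.
by apply: inKD; [apply: IH|apply: inKZ].
Qed.
Lemma inK_wd c n (u : Kz n) : inK I u -> inK I (wd c u).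
Proof.
elim: n u => [|n IH] u /=; first by move=> _; apply: (ideal0 hI).
move=> [h1 h2]; split; first exact: IH.
by apply: inKB; [apply: inKZ|apply: IH].
Qed.
Lemma inK_nzd a n (u : Kz n) : (forall b, I (a * b) -> I b) -> inK I (a *: u) -> inK I u.
Proof.
move=> ha; elim: n u => [|n IH] u /=; first exact: ha.
by move=> [h1 h2]; split; apply: IH.
Qed.
Lemma inK_last n (u : Kz n) : inK I u -> I (lastK u).
Proof. by elim: n u => [//|n IH] u /= [_]; apply: IH. Qed.
(** The coefficients of the boundary of [topK n] are the [F i] up to sign. With its converse
    [inK_bd_top_inv], this turns the socle into Koszul homology of top degree. *)
Lemma inK_bd_top F n a : (forall i, (i < n)%N -> I (a * F i)) -> inK I (bd F (a *: topK n)).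
Proof.
rewrite bdZ; elim: n => [|n IH] h /=; first by rewrite scaler0; apply: (ideal0 hI).
split; last by rewrite scalerN; apply: inKN; apply: IH => i hi; apply/h/ltnW.
by rewrite bd0 add0r scalerA; apply: inKZl; apply: h.
Qed.
Lemma inK_bd_top_inv F n a i : (i < n)%N -> inK I (bd F (a *: topK n)) -> I (a * F i).
Proof.
elim: n => [//|n IH] /=; rewrite ltnS leq_eqVlt => /orP[/eqP ->|ni] [/= h1 h2].
  move: h1; rewrite scaler0 bd0 add0r => /inK_last.
  by rewrite !lastZ last_top mulr1 mulrC.
by apply: IH => //; rewrite -[bd F _]opprK; apply: inKN.
Qed.
End InK.

Lemma inK_sub I J n (u : Kz n) : (forall a, I a -> J a) -> inK I u -> inK J u.
Proof. by move=> h; elim: n u => [|n IH] u /=; [apply: h|move=> [/IH h1 /IH h2]]. Qed.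
Lemma inK_idl0 f n (u : Kz n) : inK (idl f 0) u -> u = 0.
Proof.
elim: n u => [|n IH] u /=; first by move=> [c ->]; rewrite big_ord0.
by case: u => u v /= [/IH -> /IH ->].
Qed.
Lemma idlS f k a : idl f k.+1 a -> exists b r, idl f k b /\ a = r * f k + b.
Proof.
move=> [c ->]; rewrite big_ord_recr /= addrC; exists (\sum_(i < k) c i * f i), (c k).
by split=> //; exists c.
Qed.
Lemma idl_le f k l a : (k <= l)%N -> idl f k a -> idl f l a.
Proof. by move=> kl; apply: idl_sub => // i ik; apply/mem_idl/(leq_trans ik). Qed.
Lemma inK_idlS f k n i (u : Kz n) : deg i u -> inK (idl f k.+1) u ->
  exists v w, [/\ deg i v, inK (idl f k) w & u = f k *: v + w].
Proof.
elim: n i u => [|n IH] i u /=.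
  case: i => [_ /idlS [b [r [hb e]]]|i -> _].
    by exists r, b; split=> //; rewrite e mulrC.
  by exists 0, 0; split=> //; [apply: (ideal0 (ideal_idl _ _))|rewrite scaler0 addr0].
case: u => u v /= [h1 h2] [k1 k2].
have [v1 [w1 [d1 q1 ->]]] := IH i u h1 k1.
case: i h1 h2 d1 => [|i] h1 h2 d1.
  exists (v1, 0), (w1, 0); split=> //=.
    by split=> //; apply: inK0.
  apply: (@f_equal2 _ _ _ (@pair _ _) _ _ _ (f k *: 0 + 0)) => //.
  by rewrite h2 scaler0 addr0.
have [v2 [w2 [d2 q2 ->]]] := IH i v h2 k2.
by exists (v1, v2), (w1, w2).
Qed.

Definition reg f r := forall k a, (k < r)%N -> idl f k (f k * a) -> idl f k a.

Lemma wd_ext b c n (u : Kz n) : (forall i, (i < n)%N -> b i = c i) -> wd b u = wd c u.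
Proof.
elim: n u => [//|n IH] u h /=.
by rewrite !IH ?h // => i hi; apply/h/ltnW.
Qed.
Lemma wd_lin b c a n (u : Kz n) : wd (fun i => b i + a * c i) u = wd b u + a *: wd c u.
Proof.
elim: n u => [|n IH] u /=; first by rewrite scaler0 addr0.
rewrite !IH; apply: (@f_equal2 _ _ _ (@pair _ _) _ (wd b u.1 + a *: wd c u.1) _
  ((b n *: u.1 - wd b u.2) + a *: (c n *: u.1 - wd c u.2))) => //.
by rewrite scalerDl scalerBr scalerA opprD addrACA.
Qed.
Lemma wd_one_inj b c n : wd b (oneK n) = wd c (oneK n) -> forall i, (i < n)%N -> b i = c i.
Proof.
elim: n => [//|n IH] /= [h1]; rewrite !wd0 !subr0 => /one_inj h2 i.
by rewrite ltnS leq_eqVlt => /orP[/eqP -> //|/IH]; apply.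
Qed.
Lemma deg1_wd n (u : Kz n) : deg 1 u -> exists b, u = wd b (oneK n).
Proof.
elim: n u => [|n IH] u /=; first by move=> ->; exists (fun=> 0).
case: u => u v /= [/IH [b ->] /deg0_one [a ->]].
exists (fun i => if i == n then a else b i).
apply: (@f_equal2 _ _ _ (@pair _ _)) => /=; last by rewrite eqxx wd0 subr0.
by apply: wd_ext => i; case: eqVneq => // ->; rewrite ltnn.
Qed.

Definition alternating (N : nat -> nat -> R) :=
  (forall i, N i i = 0) /\ (forall i j, N j i = - N i j).

Lemma bd_deg2 F n (w : Kz n) : deg 2 w ->
  exists N, alternating N /\ bd F w = wd (fun i => \sum_(j < n) N i j * F j) (oneK n).
Proof.
elim: n w => [|n IH] w /=.
  by exists (fun _ _ => 0); split=> //; split=> *; rewrite ?oppr0.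
case: w => u v /= [/IH [N [[N1 N2] ->]] /deg1_wd [b ->]].
exists (fun i j => if i == n then (if j == n then 0 else - b j) else if j == n then b i else N i j).
split.
  split=> [i|i j]; first by case: eqVneq.
  by case: eqVneq => _; case: eqVneq => _ //; rewrite ?opprK ?oppr0.
rewrite bd_wd bd_one wd0 subr0.
apply: (@f_equal2 _ _ _ (@pair _ _)) => /=; last first.
  rewrite wd0 subr0 -scaleNr; congr (_ *: _); rewrite big_ord_recr /= !eqxx mul0r addr0 -sumrN.
  by apply: eq_bigr => i _; rewrite (ltn_eqF (ltn_ord i)) mulNr.
rewrite -wd_lin; apply: wd_ext => i hi; rewrite (ltn_eqF hi) big_ord_recr /= eqxx (mulrC (F n)).
by congr (_ + _); apply: eq_bigr => j _; rewrite (ltn_eqF (ltn_ord j)).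
Qed.

(** Vanishing of the first Koszul homology in coordinates: every relation between the [F i] is a
    combination of the trivial ones. *)
Definition acyc F n := forall z : nat -> R, \sum_(i < n) z i * F i = 0 ->
  exists N, alternating N /\ forall i, (i < n)%N -> z i = \sum_(j < n) N i j * F j.

(** * Koszul homology of generators whose ideal contains a regular sequence *)

Section RegularInside.
Variables (F f : nat -> R) (n r : nat) (c : nat -> nat -> R).
Hypothesis (hreg : reg f r).
Hypothesis (hc : forall k, (k < r)%N -> f k = \sum_(i < n) c k i * F i).

(* The wedge product with a lift of [f k] carries a cycle modulo [(f_0, ..., f_(k-1))] to a cycle
   modulo [(f_0, ..., f_k)] of one degree more; in degree [n + 1] there is nothing left. *)
Lemma koszul_vanish t i k (z : Kz n) : (i + t = n.+1)%N -> (k + t <= r)%N -> deg i z ->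
  inK (idl f k) (bd F z) -> exists w, deg i.+1 w /\ inK (idl f k) (z - bd F w).
Proof.
elim: t i k z => [|t IH] i k z.
  rewrite addn0 => -> _ /(deg_big (ltnSn n)) -> _.
  by exists 0; split; [apply: deg0K|rewrite bd0 subr0; apply: inK0].
rewrite !addnS => it kt dz hz; have kr : (k < r)%N by apply: leq_trans kt; rewrite ltnS leq_addr.
have hbw : bd F (wd (c k) z) = f k *: z - wd (c k) (bd F z) by rewrite bd_wd -hc.
have [||||w [dw hw]] := IH i.+1 k.+1 (wd (c k) z).
- by rewrite addSn.
- by rewrite addSn.
- exact: deg_wd.
- rewrite hbw; apply: inKB => //; first by apply/inKZl => //; apply: mem_idl.
  by apply: inK_wd => //; apply: inK_sub hz => a; apply: idl_le.
have dy : deg i.+1 (wd (c k) z - bd F w) by apply: degB; [apply: deg_wd|apply: deg_bd].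
have [u [q [du hq e]]] := inK_idlS dy hw.
(* The boundary of equation [e] reads [f k *: (z - bd F u) = bd F q + wd (c k) (bd F z)], where the
   right side vanishes modulo the earlier elements; regularity cancels [f k]. *)
exists u; split=> //; apply: (@inK_nzd _ (f k)); first by move=> b; apply: hreg.
have := congr1 (@bd F n) e; rewrite !(bdD, bdN, bdZ) bd_bd subr0 hbw => e2.
have -> : f k *: (z - bd F u) = bd F q + wd (c k) (bd F z).
  by rewrite scalerBr; apply/eqP; rewrite subr_eq -addrA addrC -addrA -e2 addrC subrK.
by apply: inKD => //; [apply: inK_bd|apply: inK_wd].
Qed.

(** If [r > n], the vanishing reaches degree zero over the ring itself and makes [oneK n] a
    boundary, that is, [1] a combination of the [F i]. *)
Lemma regular_length : ~ idl F n 1 -> (r <= n)%N.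
Proof.
move=> n1; rewrite leqNgt; apply/negP => nr; apply: n1.
have [||||w [dw /inK_idl0 /eqP]] := @koszul_vanish n.+1 0 0 (oneK n) => //.
- exact: deg_one.
- by rewrite bd_one; apply: inK0.
rewrite subr_eq0 => /eqP; have [b ->] := deg1_wd dw.
rewrite bd_wd bd_one wd0 subr0 -{1}(scale1r (oneK n)) => /one_inj ->.
by exists b.
Qed.

Hypothesis (nr : n = r).

Lemma acyc_of_regular : acyc F n.
Proof.
move=> z hz.
have [||||w [dw /inK_idl0 /eqP]] := @koszul_vanish n 1 0 (wd z (oneK n)) => //.
- by rewrite nr.
- exact/deg_wd/deg_one.
- by rewrite bd_wd bd_one wd0 subr0 hz scale0r; apply: inK0.
rewrite subr_eq0 => /eqP; have [N [hN ->]] := bd_deg2 F dw.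
by move/wd_one_inj => h; exists N.
Qed.

(** The wedge of the lifts of [f_(k-1), ..., f_0], a cycle modulo these elements; the coefficient of
    [om n] is, up to sign, the determinant of the matrix expressing [f] by [F]. *)
Let om := fix om k : Kz n := if k is k'.+1 then wd (c k') (om k') else oneK n.

Let deg_om j : deg j (om j).
Proof. by elim: j => [|j IH]; [apply: deg_one|apply: deg_wd]. Qed.

Let bd_om j : (j <= n)%N -> inK (idl f j) (bd F (om j)).
Proof.
elim: j => [_|j IH jn]; first by rewrite bd_one; apply: inK0.
rewrite /= bd_wd -hc -?nr //; apply: inKB => //; first by apply/inKZl => //; apply: mem_idl.
by apply: inK_wd => //; apply: inK_sub (IH (ltnW jn)) => a; apply: idl_le.
Qed.

(** The connecting map for [f k] lowers both the degree and the number of elements. In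
    [bd F z = f k *: v + q] the element [v] is a cycle modulo one element fewer; once it is
    [a *: om k] plus a boundary [bd F w], the difference [z - a *: om k.+1 - f k *: w] is a cycle to
    which [koszul_vanish] applies. *)
Let koszul_cyclic k (z : Kz n) : (k <= n)%N -> deg k z -> inK (idl f k) (bd F z) ->
  exists a w, deg k.+1 w /\ inK (idl f k) (z - a *: om k - bd F w).
Proof.
elim: k z => [|k IH] z kn dz hz.
  have [a ->] := deg0_one dz; exists a, 0; split; first exact: deg0K.
  by rewrite bd0 subr0 subrr; apply: inK0.
have kr : (k < r)%N by rewrite -nr.
have [v [q [dv hq e]]] := inK_idlS (deg_bd F dz) hz.
have [|a [w [dw hw]]] := IH v (ltnW kn) dv.
  apply: (@inK_nzd _ (f k)); first by move=> b; apply: hreg.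
  have := congr1 (@bd F n) e; rewrite bd_bd bdD bdZ => /eqP; rewrite eq_sym addr_eq0 => /eqP ->.
  by apply: inKN => //; apply: inK_bd.
have [||||w' [dw' hw']] := @koszul_vanish (n - k.+1).+1 k.+1 k (z - a *: om k.+1 - f k *: w).
- by rewrite addnS subnKC.
- by rewrite addnS -addSn subnKC // nr.
- by apply: degB; [apply: degB => //; apply/degZ/deg_om|apply: degZ].
- rewrite !(bdD, bdN, bdZ) e /= bd_wd -hc //.
  set o := om k; have ho : inK (idl f k) (wd (c k) (bd F o)).
    by apply: inK_wd => //; apply/bd_om/ltnW.
  have -> : f k *: v + q - a *: (f k *: o - wd (c k) (bd F o)) - f k *: bd F w =
     f k *: (v - a *: o - bd F w) + q + a *: wd (c k) (bd F o).
    rewrite !scalerBr !scalerA (mulrC a) opprB.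
    by rewrite [LHS](AC (2*2*1) (1*4*5*2*3)).
  by apply: inKD => //; [apply: inKD => //; apply: inKZ|apply: inKZ].
exists a, w'; split=> //.
rewrite -(subrK (f k *: w) (z - _)) -addrA [_ *: w - _]addrC addrA.
apply: inKD => //; last by apply/inKZl => //; apply: mem_idl.
by apply: inK_sub hw' => b; apply: idl_le.
Qed.

(** Case [k = n] of [koszul_cyclic]: nothing lies in degree [n + 1], so no boundary disturbs the top
    degree. *)
Lemma socle_cyclic : exists o, (forall i, (i < n)%N -> idl f n (o * F i)) /\
  forall a, (forall i, (i < n)%N -> idl f n (a * F i)) -> exists b, idl f n (a - b * o).
Proof.
exists (lastK (om n)); split=> [i ni|a ha].
  apply: (inK_bd_top_inv (ideal_idl f n) ni).
  by rewrite -degn_top //; apply: bd_om.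
have [|||b [w [dw hw]]] := @koszul_cyclic n (a *: topK n) => //.
- exact/degZ/deg_top.
- exact: inK_bd_top.
exists b; move: hw; rewrite (deg_big (ltnSn n) dw) bd0 subr0 => /(inK_last).
by rewrite -scaleN1r !(lastD, lastZ) last_top mulr1 mulN1r.
Qed.
End RegularInside.
End Koszul.

(** * Regular sequences in local rings *)

Section LocalRegular.
Variable R : comNzRingType.
Hypothesis hR : noetherian R.
Implicit Types (I J P Q : R -> Prop) (F G f : nat -> R).

Lemma idl_ext F G n a : (forall i, (i < n)%N -> F i = G i) -> idl F n a -> idl G n a.
Proof. by move=> h; apply: idl_sub => // i hi; rewrite h //; apply: mem_idl. Qed.

(** Induction on the number of coordinates: the values of the last one form an ideal, whose
    generators are lifted to [W], and what remains vanishes there. It supplies the finite generation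
    of relations that Nakayama requires. *)
Lemma submodule_fg n (W : (nat -> R) -> Prop) :
  W (fun=> 0) -> (forall u v, W u -> W v -> W (fun i => u i + v i)) ->
  (forall r u, W u -> W (fun i => r * u i)) ->
  exists t (w : nat -> nat -> R), (forall l, (l < t)%N -> W (w l)) /\
    forall z, W z -> exists c : nat -> R, forall i, (i < n)%N -> z i = \sum_(l < t) c l * w l i.
Proof.
elim: n W => [|n IH] W W0 WD WZ; first by exists 0%N, (fun _ _ => 0); split=> // z _; exists (fun=> 0).
have Wsum (T : Type) (s : seq T) (c : T -> R) (u : T -> nat -> R) :
    (forall l, W (u l)) -> exists2 v, W v & forall i, v i = \sum_(l <- s) c l * u l i.
  move=> hu; elim: s => [|l s [v hv ev]]; first by exists (fun=> 0) => // i; rewrite big_nil.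
  exists (fun i => c l * u l i + v i); last by move=> i; rewrite big_cons ev.
  by apply: (WD (fun i => c l * u l i)) => //; apply: WZ.
have [|k [F hF]] := @noeth_fg R (fun a => exists2 z, W z & z n = a) hR.
  split; first by exists (fun=> 0).
  split=> [_ _ [u hu <-] [v hv <-]|r _ [u hu <-]]; first by exists (fun i => u i + v i) => //; apply: WD.
  by exists (fun i => r * u i) => //; apply: WZ.
have /fin_all_exists [y hy] : forall l : 'I_k, exists y, W y /\ y n = F l.
  by move=> l; have [y hy ey] := proj2 (hF (F l)) (mem_idl F (ltn_ord l)); exists y.
have [|||t [w [hw1 hw2]]] := IH (fun z => W z /\ z n = 0).
- by [].
- by move=> u v [hu eu] [hv ev]; split; [apply: WD|rewrite eu ev addr0].
- by move=> r u [hu eu]; split; [apply: WZ|rewrite eu mulr0].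
pose w' l := if insub l is Some l' then y l' else w (l - k)%N.
have w'l (l : 'I_k) : w' l = y l by rewrite /w' valK.
have w'r l : w' (k + l)%N = w l.
  by rewrite /w' insubF ?addKn // ltnNge leq_addr.
exists (k + t)%N, w'; split.
  move=> l; case: (ltnP l k) => lk.
    by rewrite -[l]/(val (Ordinal lk)) w'l => _; case: (hy (Ordinal lk)).
  by rewrite -{1 2}(subnKC lk) ltn_add2l w'r => /hw1 [].
move=> z hz; have [|c ec] := proj1 (hF (z n)); first by exists z.
have [v hv ev] := Wsum _ (index_enum 'I_k) (fun l : 'I_k => - c l) y (fun l => proj1 (hy l)).
have vn : z n + v n = 0.
  rewrite ev ec -big_split big1 //= => l _; case: (hy l) => _ ->; by rewrite mulNr subrr.
have [c' hc'] := hw2 (fun i => z i + v i) (conj (WD _ _ hz hv) vn).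
exists (fun l => if (l < k)%N then c l else c' (l - k)%N) => i hi.
rewrite big_split_ord /=.
have -> : z i = - v i + (z i + v i) by rewrite addrC addrK.
congr (_ + _).
  rewrite ev -sumrN; apply: eq_bigr => l _.
  by rewrite ltn_ord w'l mulNr opprK.
transitivity (\sum_(l < t) c' l * w l i); last first.
  by apply: eq_bigr => l _; rewrite ltnNge leq_addr /= addKn w'r.
move: hi; rewrite ltnS leq_eqVlt => /orP[/eqP ->|/hc' //].
by rewrite vn big1 // => l _; case: (hw1 l (ltn_ord l)) => _ ->; rewrite mulr0.
Qed.

Variable M : R -> Prop.
Hypothesis hM : local_with_max M.
Let pM := local_prime hM.
Let iM := prime_is_ideal pM.

(** A relation among the first [n] elements, extended by zero, comes from an alternating [N], whose
    last column is again such a relation. So relations are trivial ones plus [F n] times relations,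
    and Nakayama removes the latter. *)
Lemma acyc_pred F n : M (F n) -> acyc F n.+1 -> acyc F n.
Proof.
move=> Fn hF.
have [|||t [w [hw1 hw2]]] := @submodule_fg n (fun z => \sum_(i < n) z i * F i = 0).
- by rewrite big1 // => i _; rewrite mul0r.
- move=> u v hu hv; transitivity (\sum_(i < n) u i * F i + \sum_(i < n) v i * F i).
    by rewrite -big_split; apply: eq_bigr => i _; rewrite mulrDl.
  by rewrite hu hv addr0.
- move=> r u hu; transitivity (r * \sum_(i < n) u i * F i).
    by rewrite mulr_sumr; apply: eq_bigr => i _; rewrite mulrA.
  by rewrite hu mulr0.
pose B (v : 'rV[R]_n) := exists N, alternating N /\ forall i, v 0 i = \sum_(j < n) N i j * F j.
have B0 : B 0.
  exists (fun _ _ => 0); split; first by split=> *; rewrite ?oppr0.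
  by move=> i; rewrite mxE big1 // => j _; rewrite mul0r.
have BD u v : B u -> B v -> B (u + v).
  move=> [N [[N1 N2] hN]] [N' [[N1' N2'] hN']]; exists (fun i j => N i j + N' i j); split.
    by split=> [i|i j]; rewrite ?N1 ?N1' ?addr0 // N2 N2' opprD.
  by move=> i; rewrite mxE hN hN' -big_split; apply: eq_bigr => j _; rewrite mulrDl.
have BZ r u : B u -> B (r *: u).
  move=> [N [[N1 N2] hN]]; exists (fun i j => r * N i j); split.
    by split=> [i|i j]; rewrite ?N1 ?mulr0 // N2 mulrN.
  by move=> i; rewrite mxE hN mulr_sumr; apply: eq_bigr => j _; rewrite mulrA.
have [|s [ns hs]] := @nakayama R 'rV[R]_n B M t (fun l => \row_i w l i) pM B0 BD BZ.
  move=> l; have hl := hw1 l (ltn_ord l).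
  have [|N [[N1 N2] hN]] := hF (fun i => if (i < n)%N then w l i else 0).
    rewrite big_ord_recr /= ltnn mul0r addr0 -[RHS]hl.
    by apply: eq_bigr => i _; rewrite ltn_ord.
  have [|b hb] := hw2 (fun i => N i n).
    have := hN n (ltnSn n); rewrite ltnn big_ord_recr /= N1 mul0r addr0 => h0.
    transitivity (- \sum_(j < n) N n j * F j); last by rewrite -h0 oppr0.
    by rewrite -sumrN; apply: eq_bigr => i _; rewrite N2 mulNr.
  exists 1, (\row_i \sum_(j < n) N i j * F j), (fun l => F n * b l); split.
  - exact: prime_n1.
  - by exists N; split=> // i; rewrite mxE.
  - by move=> j; apply: idealMr.
  rewrite scale1r; apply/rowP => i; rewrite !mxE summxE.
  have := hN i (leqW (ltn_ord i)); rewrite ltn_ord => ->.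
  rewrite big_ord_recr /=; congr (_ + _); rewrite hb // mulr_suml; apply: eq_bigr => j _.
  by rewrite !mxE; ring.
have [s' es] := local_unit hR hM ns.
move=> z /hw2 [c hc].
have [N [hN1 hN2]] : B (\row_i z i).
  have -> : \row_(i < n) z i = \sum_(l < t) c l *: (s' *: (s *: \row_(i < n) w l i)).
    apply/rowP => i; rewrite mxE summxE hc //; apply: eq_bigr => l _.
    by rewrite !mxE (mulrA s') es mul1r.
  by elim/big_ind: _ => // l _; do 2 apply: (BZ); apply: hs.
by exists N; split=> // i hi; have := hN2 (Ordinal hi); rewrite mxE.
Qed.

(** In a relation with last coefficient [a], row [k] of the alternating matrix has zero diagonal
    entry and writes [a] by the earlier elements only. *)
Lemma reg_of_acyc F n : (forall i, (i < n)%N -> M (F i)) -> acyc F n -> reg F n.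
Proof.
move=> MF hF k a kn [c e].
have hk : acyc F k.+1.
  elim: n kn MF hF => // n IH; rewrite ltnS leq_eqVlt => /orP[/eqP -> //|kn] MF hF.
  by apply: IH => // [i hi|]; [apply/MF/ltnW|apply: acyc_pred => //; apply: MF].
have [|N [[N1 N2] hN]] := hk (fun i => if i == k then a else - c i).
  rewrite big_ord_recr /= eqxx mulrC e -[RHS](addNr (\sum_(i < k) c i * F i)) -sumrN.
  by congr (_ + _); apply: eq_bigr => i _; rewrite (ltn_eqF (ltn_ord i)) mulNr.
have := hN k (ltnSn k); rewrite eqxx big_ord_recr /= N1 mul0r addr0 => ->.
by exists (N k).
Qed.

(** Passing through [acyc] frees regularity from the order and choice of generators; sequences are
    permuted, raised to powers and replaced by this means. *)
Lemma reg_inside F f n : (forall i, (i < n)%N -> M (F i)) -> reg f n ->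
  (forall k, (k < n)%N -> idl F n (f k)) -> acyc F n /\ reg F n.
Proof.
move=> MF hf hfF.
have /fin_all_exists [c hc] : forall k : 'I_n, exists c : nat -> R, f k = \sum_(i < n) c i * F i.
  by move=> k; apply: hfF.
pose c' k := if insub k is Some k' then c k' else fun=> 0.
have hF : acyc F n.
  apply: (@acyc_of_regular _ F f n n c') => // k hk.
  by rewrite (hc (Ordinal hk)) /c' insubT.
by split=> //; apply: reg_of_acyc.
Qed.

Lemma reg_cyclic_socle F f n : reg f n -> (forall k, (k < n)%N -> idl F n (f k)) ->
  exists o, (forall i, (i < n)%N -> idl f n (o * F i)) /\
    forall a, (forall i, (i < n)%N -> idl f n (a * F i)) -> exists b, idl f n (a - b * o).
Proof.
move=> hf hfF.
have /fin_all_exists [c hc] : forall k : 'I_n, exists c : nat -> R, f k = \sum_(i < n) c i * F i.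
  by move=> k; apply: hfF.
pose c' k := if insub k is Some k' then c k' else fun=> 0.
apply: (@socle_cyclic _ F f n n c') => // k hk.
by rewrite (hc (Ordinal hk)) /c' insubT.
Qed.

Lemma reg_length F f n r : (forall i, (i < n)%N -> M (F i)) -> reg f r ->
  (forall k, (k < r)%N -> idl F n (f k)) -> (r <= n)%N.
Proof.
move=> MF hf hfF.
have /fin_all_exists [c hc] : forall k : 'I_r, exists c : nat -> R, f k = \sum_(i < n) c i * F i.
  by move=> k; apply: hfF.
pose c' k := if insub k is Some k' then c k' else fun=> 0.
apply: (@regular_length _ F f n r c') => //.
  by move=> k hk; rewrite (hc (Ordinal hk)) /c' insubT.
by move=> h; apply: (prime_n1 pM); apply: idl_sub h.
Qed.

Lemma idealX I a k : is_ideal I -> (0 < k)%N -> I a -> I (a ^+ k).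
Proof. by case: k => // k hI _ Ia; rewrite exprSr; apply: idealMl. Qed.

(** One exponent at a time: the element is moved to the last place, where a power visibly keeps
    regularity, and [reg_inside] justifies the permutations. *)
Lemma reg_pow F n (e : nat -> nat) : (forall i, (i < n)%N -> M (F i)) -> (forall i, 0 < e i)%N ->
  reg F n -> reg (fun i => F i ^+ e i) n.
Proof.
move=> MF e0 hF.
have key k : (k <= n)%N -> reg (fun i => if (i < k)%N then F i ^+ e i else F i) n.
  elim: k => [|k IH] kn //; have {IH} := IH (ltnW kn).
  set H := fun i : nat => if (i < k)%N then _ else _ => hH.
  set H' := fun i : nat => _.
  case: n kn MF hH hF => // n kn MF hH hF.
  pose sw i := if i == k then n else if i == n then k else i.
  have swK i : sw (sw i) = i.
    rewrite /sw; case: (eqVneq i k) => [->|ik]; first by rewrite eqxx; case: eqVneq.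
    case: (eqVneq i n) => [->|inn]; first by rewrite eqxx.
    by rewrite (negPf ik) (negPf inn).
  have swn i : (i < n.+1)%N -> (sw i < n.+1)%N.
    by rewrite /sw => hi; case: eqVneq => // _; case: eqVneq.
  have MH i : (i < n.+1)%N -> M (H i).
    by move=> hi; rewrite /H; case: ifP => _; [apply: idealX => //|]; apply: MF.
  have MH' i : (i < n.+1)%N -> M (H' i).
    by move=> hi; rewrite /H'; case: ifP => _; [apply: idealX => //|]; apply: MF.
  have [|_ h1] := @reg_inside (fun i => H (sw i)) H n.+1 (fun i hi => MH _ (swn i hi)) hH.
    move=> j hj; rewrite -{1}(swK j); apply: (@mem_idl _ (fun i => H (sw i))); exact: swn.
  pose G i := if i == n then H k ^+ e k else H (sw i).
  have hG : reg G n.+1.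
    move=> j a hj.
    have eG i : (i < j)%N -> G i = H (sw i).
      by move=> ij; rewrite /G ltn_eqF // (leq_trans ij).
    move=> /(idl_ext eG) h; apply: (@idl_ext (fun i => H (sw i))).
      by move=> i ij; rewrite eG.
    move: h; rewrite /G; case: eqVneq => [jn|_]; last exact: h1.
    have -> : H k = H (sw j) by rewrite jn /sw; case: eqVneq => [->|]; rewrite ?eqxx.
    elim: (e k) => [|d IHd]; first by rewrite expr0 mul1r.
    by rewrite exprS -mulrA => /(h1 _ _ hj).
  have [|_ //] := @reg_inside H' G n.+1 MH' hG.
  move=> j hj; have -> : G j = H' (sw j).
    rewrite /G /H' /H /sw; case: (eqVneq j n) => [->|jn].
      by case: (eqVneq n k) => [->|_]; rewrite ltnn ltnSn.
    case: (eqVneq j k) => [jk|jk].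
      move: hj; rewrite ltnS leq_eqVlt (negPf jn) /= => {}hj; rewrite jk in hj.
      have -> : (n < k)%N = false by rewrite ltnNge (ltnW hj).
      by have -> : (n < k.+1)%N = false by rewrite ltnS leqNgt hj.
    by rewrite ltnS (leq_eqVlt j k) (negPf jk).
  by apply: mem_idl; apply: swn.
move=> k a kn; have := key n (leqnn n) k a kn; rewrite kn => h /(idl_ext _) {}h'.
have hext i : (i < k)%N -> F i ^+ e i = if (i < n)%N then F i ^+ e i else F i.
  by move=> ik; rewrite (ltn_trans ik kn).
by apply: (idl_ext (fun i ik => esym (hext i ik))); apply/h/h'/hext.
Qed.

(** If [e i > 1], a membership yields a relation between the powers in which [F i] has exponent one;
    acyclicity then puts the product for the lowered exponent into the corresponding ideal. When all
    exponents are one, [1] would lie in [M]. *)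
Lemma prod_notin_pow F n (e : nat -> nat) : (forall i, (i < n)%N -> M (F i)) -> reg F n ->
  (forall i, 0 < e i)%N -> ~ idl (fun i => F i ^+ e i) n (\prod_(i < n) F i ^+ (e i).-1).
Proof.
move=> MF hF.
have [N] := ubnP (\sum_(i < n) (e i).-1); elim: N e => // N IH e hN e0.
have [[i hi]|hn] := classic (exists i : 'I_n, (1 < e i)%N); last first.
  rewrite big1 => [h|i _]; last first.
    case E : (e i) (e0 i) => [//|[|d]] _; first by rewrite expr0.
    by case: hn; exists i; rewrite E.
  apply: (prime_n1 pM); apply: idl_sub h => // i hi.
  by apply: idealX => //; apply: MF.
pose e' (j : nat) := if j == i :> nat then (e i).-1 else e j.
pose e1 (j : nat) := if j == i :> nat then 1%N else e j.
have e'0 j : (0 < e' j)%N by rewrite /e'; case: eqP => // _; case: (e i) hi => // -[].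
have e10 j : (0 < e1 j)%N by rewrite /e1; case: eqP.
have lt : (\sum_(j < n) (e' j).-1 < N)%N.
  move: hN; rewrite (bigD1 i) //= ltnS => hN; rewrite (bigD1 i) //=.
  rewrite (eq_bigr (fun j : 'I_n => (e j).-1)) => [|j ji]; last by rewrite /e' val_eqE (negPf ji).
  apply: leq_trans hN; rewrite ltn_add2r /e' eqxx.
  by case: (e i) hi => // -[].
move=> [c ec]; apply: (IH e' lt e'0).
have Me1 j : (j < n)%N -> M (F j ^+ e1 j) by move=> hj; apply: idealX => //; apply: MF.
have [|hac _] := @reg_inside (fun j => F j ^+ e1 j) _ n Me1 (reg_pow MF e10 hF).
  by move=> j hj; apply: (@mem_idl _ (fun j => F j ^+ e1 j)).
set p := \prod_(j < n) _.
have ep : \prod_(j < n) F j ^+ (e j).-1 = p * F i.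
  rewrite /p (bigD1 i) //= [in RHS](bigD1 i) //=. rewrite /e' eqxx.
  have {1}-> : (e i).-1 = (e i).-1.-1.+1 by case: (e i) hi => // -[].
  rewrite exprSr mulrAC; congr (_ * _ * _); apply: eq_bigr => j ji.
  by rewrite val_eqE (negPf ji).
have e1i : e1 i = 1%N by rewrite /e1 eqxx.
have [|N0 [[N1 N2] hN0]] := hac (fun j : nat => if j == i :> nat then p - c i * F i ^+ (e i).-1 else - c j).
  transitivity (p * F i - \sum_(j < n) c j * F j ^+ e j); last by rewrite -ep ec subrr.
  rewrite (bigD1 i) //= [in RHS](bigD1 i) //= eqxx e1i expr1 opprD addrA mulrBl.
  congr (_ - _ + _).
    by rewrite -mulrA -exprSr prednK.
  by rewrite -sumrN; apply: eq_bigr => j ji; rewrite /e1 val_eqE (negPf ji) mulNr.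
have := hN0 i (ltn_ord i); rewrite eqxx => /eqP; rewrite subr_eq => /eqP ->.
apply: idealD => //.
  apply: ideal_sum => // j _; rewrite /e1; case: eqVneq => [ji|ji].
    by rewrite ji N1 mul0r; apply: (ideal0 (ideal_idl _ _)).
  apply: idealMl => //; have -> : F j ^+ e j = F j ^+ e' j by rewrite /e' (negPf ji).
  exact: (@mem_idl _ (fun j => F j ^+ e' j)).
apply: idealMl => //; have -> : F i ^+ (e i).-1 = F i ^+ e' i by rewrite /e' eqxx.
exact: (@mem_idl _ (fun j => F j ^+ e' j)).
Qed.

End LocalRegular.

(** * Cycles, boundaries and determinants *)

Section Boundaries.
Variable A : comNzRingType.
Implicit Types (I M : A -> Prop).

Definition inI I m n (B : 'M[A]_(m, n)) := forall i j, I (B i j).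

Lemma inI_mulr I m n p (B : 'M[A]_(m, n)) (C : 'M_(n, p)) : is_ideal I -> inI I B -> inI I (B *m C).
Proof. by move=> hI hB i j; rewrite mxE; apply: ideal_sum => // k _; apply: idealMr. Qed.

Lemma mul_colE m n p (x : 'M[A]_(m, n)) (B : 'M_(n, p)) i j : (x *m col j B) i 0 = (x *m B) i j.
Proof. by rewrite !mxE; apply: eq_bigr => k _; rewrite mxE. Qed.

Lemma ideal_zero : is_ideal (fun a : A => a = 0).
Proof. by split=> //; split=> [a b -> ->|r a ->]; [exact: addr0|exact: mulr0]. Qed.

(** The terms [(i, j)] and [(j, i)] are paired; the diagonal is handled apart, so no division by two
    occurs. *)
Lemma ideal_alt_sum I n (u : 'I_n -> 'I_n -> A) : is_ideal I -> (forall i, I (u i i)) ->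
  (forall i j, I (u i j + u j i)) -> I (\sum_i \sum_j u i j).
Proof.
move=> hI h1 h2.
have -> : \sum_i \sum_j u i j =
    \sum_(i < n) \sum_(j < n) (if (i < j)%N then u i j + u j i else 0) + \sum_(i < n) \sum_(j < n) (if i == j then u i j else 0).
  have -> : \sum_i \sum_j u i j = \sum_(i < n) \sum_(j < n) (if (i < j)%N then u i j else 0) +
      \sum_(i < n) \sum_(j < n) (if (j < i)%N then u i j else 0) + \sum_(i < n) \sum_(j < n) (if i == j then u i j else 0).
    rewrite -!big_split; apply: eq_bigr => i _; rewrite -!big_split; apply: eq_bigr => j _ /=.
    by rewrite -val_eqE; case: ltngtP => _; rewrite ?addr0 ?add0r.
  congr (_ + _); rewrite [X in _ + X]exchange_big -big_split; apply: eq_bigr => i _.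
  by rewrite -big_split; apply: eq_bigr => j _ /=; case: ltnP => _; rewrite ?addr0.
apply: idealD => //; apply: ideal_sum => // i _; apply: ideal_sum => // j _.
  by case: ifP => _; [apply: h2|apply: ideal0].
by case: eqP => [->|_]; [apply: h1|apply: ideal0].
Qed.

Definition altm n (N : 'M[A]_n) := (forall i, N i i = 0) /\ forall i j, N j i = - N i j.

(* Boundaries of degree one in the Koszul complex of [x]. *)
Definition bdry n (x : 'rV[A]_n) (z : 'cV_n) := exists N, altm N /\ z = N *m x^T.
Definition kos n p (x : 'rV[A]_n) (B : 'M_(n, p)) := forall j, bdry x (col j B).

Lemma bdry0 n (x : 'rV[A]_n) : bdry x 0.
Proof.
exists 0; rewrite mul0mx; split=> //; split=> [i|i j]; by rewrite !mxE ?oppr0.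
Qed.
Lemma bdryD n (x : 'rV[A]_n) u v : bdry x u -> bdry x v -> bdry x (u + v).
Proof.
move=> [N [[N1 N2] ->]] [N' [[N1' N2'] ->]]; exists (N + N'); rewrite mulmxDl; split=> //.
by split=> [i|i j]; rewrite !mxE ?N1 ?N1' ?addr0 // N2 N2' opprD.
Qed.
Lemma bdryZ n (x : 'rV[A]_n) a u : bdry x u -> bdry x (a *: u).
Proof.
move=> [N [[N1 N2] ->]]; exists (a *: N); rewrite -scalemxAl; split=> //.
by split=> [i|i j]; rewrite !mxE ?N1 ?mulr0 // N2 mulrN.
Qed.
Lemma bdryN n (x : 'rV[A]_n) u : bdry x u -> bdry x (- u).
Proof. by rewrite -scaleN1r; apply: bdryZ. Qed.
Lemma bdryB n (x : 'rV[A]_n) u v : bdry x u -> bdry x v -> bdry x (u - v).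
Proof. by move=> hu /bdryN; apply: bdryD. Qed.
Lemma kos_mul n p (x : 'rV[A]_n) (B : 'M_(n, p)) v : kos x B -> bdry x (B *m v).
Proof.
move=> hB; have -> : B *m v = \sum_j v j 0 *: col j B.
  apply/colP => i; rewrite mxE summxE; apply: eq_bigr => j _; by rewrite !mxE mulrC.
by elim/big_ind: _ => [|u w|j _]; [apply: bdry0|apply: bdryD|apply: bdryZ].
Qed.

(** [P N (x P)^T = (P N P^T) x^T], and congruence keeps matrices alternating: [P] induces a map of
    Koszul complexes. *)
Lemma bdry_functor n p (x : 'rV[A]_n) (P : 'M_(n, p)) z : bdry (x *m P) z -> bdry x (P *m z).
Proof.
move=> [N [[N1 N2] ->]]; exists (P *m N *m P^T); rewrite trmx_mul !mulmxA; split=> //.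
split=> [i|i j].
  rewrite mxE.
  have -> : \sum_j (P *m N) i j * P^T j i = \sum_j \sum_k P i k * N k j * P i j.
    by apply: eq_bigr => j _; rewrite !mxE mulr_suml.
  apply: (ideal_alt_sum ideal_zero) => [k|k l]; first by rewrite N1 mulr0 mul0r.
  by rewrite N2; ring.
have -> : (P *m N *m P^T) j i = (P *m N *m P^T)^T i j by rewrite [in RHS]mxE.
rewrite !trmx_mul trmxK mulmxA.
have -> : N^T = - N by apply/matrixP => a b; rewrite !mxE N2.
by rewrite mulmxN mulNmx mxE.
Qed.

Lemma mul_bdry n (x : 'rV[A]_n) z : bdry x z -> x *m z = 0.
Proof.
move=> [N [[N1 N2] ->]]; apply/matrixP => i j; rewrite !ord1 mulmxA !mxE.
have -> : \sum_j (x *m N) 0 j * x^T j 0 = \sum_j \sum_k x 0 k * N k j * x 0 j.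
  by apply: eq_bigr => k _; rewrite !mxE mulr_suml.
apply: (ideal_alt_sum ideal_zero) => [k|k l]; first by rewrite N1 mulr0 mul0r.
by rewrite N2; ring.
Qed.
Lemma mul_kos n p (x : 'rV[A]_n) (B : 'M_(n, p)) : kos x B -> x *m B = 0.
Proof.
move=> hB; apply/matrixP => i j; rewrite ord1 [RHS]mxE.
have := mul_bdry (hB j) => /matrixP /(_ 0 0); by rewrite mul_colE [RHS]mxE.
Qed.

Lemma mul_det n (x : 'rV[A]_n) (B : 'M_n) : \det B *: x = x *m B *m \adj B.
Proof. by rewrite -mulmxA mul_mx_adj mul_mx_scalar. Qed.

(** Replacing column [j] of [B] by the [k]-th unit vector gives a matrix of determinant
    [cofactor B k j], whose product with [x] has [x 0 k] in column [j] and entries in [I] elsewhere;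
    Cramer's rule for it is the symmetry. *)
Lemma cofactor_sym I n (x : 'rV[A]_n) (B : 'M_n) j k l : is_ideal I ->
  (forall b, b != j -> I ((x *m B) 0 b)) ->
  I (x 0 l * cofactor B k j - x 0 k * cofactor B l j).
Proof.
move=> hI hB.
pose Mk := \matrix_(a, b) (if b == j then (a == k)%:R else B a b).
have cofM a : cofactor Mk a j = cofactor B a j.
  rewrite /cofactor; congr (_ * \det _); apply/matrixP => c d; rewrite !mxE.
  by rewrite eq_sym (negPf (neq_lift _ _)).
have detM : \det Mk = cofactor B k j.
  rewrite (expand_det_col Mk j) (bigD1 k) //= big1 ?addr0 => [|a ak].
    by rewrite cofM !mxE !eqxx mul1r.
  by rewrite !mxE eqxx (negPf ak) mul0r.
have := mul_det x Mk => /matrixP /(_ 0 l); rewrite [LHS]mxE detM mulrC => ->.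
rewrite mxE (bigD1 j) //= [\adj _ _ _]mxE cofM.
have -> : (x *m Mk) 0 j = x 0 k.
  rewrite mxE (bigD1 k) //= big1 ?addr0 => [|a ak]; first by rewrite !mxE !eqxx mulr1.
  by rewrite !mxE eqxx (negPf ak) mulr0.
rewrite [X in X - _]addrC addrK; apply: ideal_sum => // b bj; apply: idealMr => //.
have -> : (x *m Mk) 0 b = (x *m B) 0 b; last exact: hB.
by rewrite !mxE; apply: eq_bigr => a _; rewrite !mxE (negPf bj).
Qed.

Lemma cofactor_bdry I n (x : 'rV[A]_n) (B : 'M_n) j z : is_ideal I ->
  (forall b, b != j -> I ((x *m B) 0 b)) -> bdry x z ->
  I (\sum_i z i 0 * cofactor B i j).
Proof.
move=> hI hB [N [[N1 N2] ->]].
have -> : \sum_i (N *m x^T) i 0 * cofactor B i j = \sum_i \sum_l N i l * x 0 l * cofactor B i j.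
  by apply: eq_bigr => i _; rewrite mxE mulr_suml; apply: eq_bigr => l _; rewrite !mxE.
apply: ideal_alt_sum => // [i|k l]; first by rewrite N1 !mul0r; apply: ideal0.
have -> : N k l * x 0 l * cofactor B k j + N l k * x 0 k * cofactor B l j =
  N k l * (x 0 l * cofactor B k j - x 0 k * cofactor B l j) by rewrite (N2 k l); ring.
by apply: idealMl => //; apply: cofactor_sym.
Qed.

(** Columns change one at a time. Successive determinants differ by the pairing of a boundary with
    cofactors, that is, of an alternating matrix with an expression symmetric modulo [I]. *)
Lemma det_kos I n (x : 'rV[A]_n) (B N : 'M_n) : is_ideal I -> inI I (x *m B) -> kos x N ->
  I (\det (B + N) - \det B).
Proof.
move=> hI hB hN.
pose H (k : nat) := \matrix_(a, b) (B a b + (if (b < k)%N then N a b else 0)).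
have key k : (k <= n)%N -> I (\det (H k) - \det B).
  elim: k => [_|k IH kn].
    have -> : H 0%N = B by apply/matrixP => a b; rewrite mxE addr0.
    by rewrite subrr; apply: ideal0.
  pose j := Ordinal kn.
  have cofH i : cofactor (H k.+1) i j = cofactor (H k) i j.
    rewrite /cofactor; congr (_ * \det _); apply/matrixP => c d; rewrite !mxE.
    have := neq_lift j d; rewrite -val_eqE /= ltnS (leq_eqVlt _ k) eq_sym => /negPf h.
    by rewrite h.
  have := IH (ltnW kn); suff : I (\det (H k.+1) - \det (H k)).
    by move=> h1 h2; have := idealD hI h1 h2; rewrite addrA subrK.
  rewrite (expand_det_col _ j) (expand_det_col (H k) j) -sumrB.
  rewrite (eq_bigr (fun i => (col j N) i 0 * cofactor (H k) i j)) => [|i _].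
    apply: (cofactor_bdry hI _ (hN j)) => b _.
    have -> : (x *m H k) 0 b = (x *m B) 0 b; last exact: hB.
    have h : \sum_i x 0 i * (if (b < k)%N then N i b else 0) = 0.
      case: (b < k)%N; last by rewrite big1 // => i _; rewrite mulr0.
      by have := congr1 (fun C : 'M_(1, n) => C 0 b) (mul_kos hN); rewrite !mxE.
    transitivity ((x *m B) 0 b + 0); last exact: addr0.
    rewrite -{}h !mxE -big_split; apply: eq_bigr => i _.
    by rewrite mxE mulrDr.
  rewrite cofH -mulrBl; congr (_ * _); rewrite !mxE /= ltnSn ltnn addr0; ring.
have := key n (leqnn n); have -> // : H n = B + N.
by apply/matrixP => a b; rewrite !mxE ltn_ord.
Qed.

(** Modulo [I], [\det psi] is [\det phi * \det b], and [\det b] multiplies the entries of [x phi]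
    into [I] because those of [x phi b] are there. *)
Lemma det_factor_notin I n (x : 'rV[A]_n) (psi phi b N : 'M_n) (c : 'cV_n) e :
  is_ideal I -> inI I (x *m psi) -> ~ I (\det psi) -> psi = phi *m b + N -> kos x N ->
  I e -> \det phi = (x *m phi *m c) 0 0 + e -> False.
Proof.
move=> hI hx hd epsi hN he edet; apply: hd.
have hxb : inI I (x *m (phi *m b)).
  have <- // : x *m psi = x *m (phi *m b).
  by rewrite epsi mulmxDr (mul_kos hN) addr0.
rewrite epsi; apply: (idealBr hI (det_kos hI hxb hN)).
rewrite det_mulmx edet mulrDl; apply: idealD => //; last exact: idealMr.
have -> : (x *m phi *m c) 0 0 * \det b = ((\det b *: (x *m phi)) *m c) 0 0.
  by rewrite -scalemxAl [RHS]mxE mulrC.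
rewrite mul_det -(mulmxA x); exact: (inI_mulr _ hI (inI_mulr _ hI hxb)).
Qed.

Lemma minor_exists I p d (B : 'M[A]_(p + d)) : is_ideal I -> ~ I (\det B) ->
  exists h : 'I_d -> 'I_(p + d), ~ I (\det (\matrix_(i, j) B (rshift p i) (h j))).
Proof.
move=> hI; elim: p B => [|p IH] B hB.
  exists id; move: hB; congr (~ I (\det _)); apply/matrixP => i j; rewrite mxE; congr (B _ _).
  exact: val_inj.
have [j hj] : exists j, ~ I (\det (row' ord0 (col' j B))).
  apply: NNPP => hn; apply: hB; rewrite (expand_det_row B ord0); apply: ideal_sum => // j _.
  apply: idealMl => //; rewrite /cofactor; apply: idealMl => //.
  by apply: NNPP => h; apply: hn; exists j.
have [h hh] := IH (row' ord0 (col' j B)) hj.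
exists (fun k => lift j (h k)); move: hh; congr (~ I (\det _)).
by apply/matrixP => a b; rewrite !mxE; congr (B _ _); apply: val_inj.
Qed.

Lemma wiebe_transfer I n d (x : 'rV[A]_n) (y : 'rV_d) (C : 'M_(d, n)) (C' : 'M_(n, d)) (phi : 'M_n) :
  is_ideal I -> x = y *m C -> y = x *m C' -> inI I (x *m phi) -> ~ I (\det phi) ->
  exists phi' : 'M_d, inI I (y *m phi') /\ ~ I (\det phi').
Proof.
move=> hI xy yx hx hd.
(* Chosen so that [(0, y) O = (x phi, 0)] and [\det O = \det phi]. Only the last [d] rows act on
   [y], so a minor taken in them, not in [I] by Laplace expansion, is the matrix sought. *)
pose O := block_mx 1%:M 0 C 1%:M *m block_mx phi (- C') 0 1%:M.
have detO : \det O = \det phi.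
  by rewrite /O det_mulmx det_lblock det_ublock !det1 !mul1r mulr1.
have [|h hh] := @minor_exists I n d O hI; first by rewrite detO.
exists (\matrix_(i, j) O (rshift n i) (h j)); split=> //.
have e : row_mx 0 y *m O = row_mx (x *m phi) 0.
  rewrite /O mulmxA mul_row_block !mul0mx add0r mulmx1 add0r -xy mul_row_block mulmx0 addr0 mulmx1.
  by rewrite mulmxN -yx addNr.
move=> i j; rewrite ord1; have := congr1 (fun B : 'rV_(n + d) => B 0 (h j)) e.
rewrite mxE big_split_ord /= big1 ?add0r => [|k _]; last by rewrite row_mxEl mxE mul0r.
have -> : (y *m \matrix_(i0, j0) O (rshift n i0) (h j0)) 0 j =
   \sum_(k < d) row_mx (0 : 'rV_n) y 0 (rshift n k) * O (rshift n k) (h j).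
  by rewrite mxE; apply: eq_bigr => k _; rewrite row_mxEr mxE.
move=> ->; rewrite mxE; case: split => k; first exact: hx.
by rewrite mxE; apply: ideal0.
Qed.

(** Over the joined sequence [w = (y, x)] the property passes from [phi1] to [O1], so [O = O1 be] up
    to boundaries. A determinant of [be] in [M] would put [\det O] into [I], since [\det O1]
    multiplies the entries of [w] into [I]. So [be] is invertible, [O] has the property too, and the
    map [(C' 1)] brings it back to [x]. *)
Lemma wiebe_generates I M n d (y : 'rV[A]_d) (x : 'rV_n) (C : 'M_(d, n)) (C' : 'M_(n, d))
    (phi1 : 'M_d) (phi : 'M_n) :
  is_ideal I -> (forall b, ~ M b -> exists b', b' * b = 1) ->
  (forall a, M a -> exists c : 'cV_d, a = (y *m c) 0 0) ->
  inI I (y *m phi1) -> (forall z : 'cV_d, I ((y *m z) 0 0) -> exists b, bdry y (z - phi1 *m b)) ->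
  x = y *m C -> y = x *m C' -> inI I (x *m phi) -> ~ I (\det phi) ->
  forall z : 'cV_n, I ((x *m z) 0 0) -> exists b, bdry x (z - phi *m b).
Proof.
move=> hI hu hM hy1 good xy yx hx hd.
pose w := row_mx y x.
pose O1 := block_mx phi1 (- C) 0 1%:M.
have wO1 : w *m O1 = row_mx (y *m phi1) 0.
  by rewrite mul_row_block mulmx0 addr0 mulmxN mulmx1 -xy addNr.
have goodw (t : 'cV_(d + n)) : I ((w *m t) 0 0) -> exists b, bdry w (t - O1 *m b).
  rewrite -[t]vsubmxK; set u := usubmx t; set v := dsubmx t.
  rewrite mul_row_col xy -mulmxA -mulmxDr => /good [b hb].
  exists (col_mx b v); rewrite mul_block_col mul0mx add0r mul1mx.
  have -> : col_mx u v - col_mx (phi1 *m b + - C *m v) v =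
      col_mx 1%:M 0 *m (u + C *m v - phi1 *m b).
    rewrite opp_col_mx add_col_mx mul_col_mx mul1mx mul0mx subrr; congr col_mx.
    by rewrite mulNmx opprD opprK [in RHS]addrAC addrA.
  apply: bdry_functor; have -> // : w *m col_mx 1%:M 0 = y.
  by rewrite mul_row_col mulmx1 mulmx0 addr0.
pose O := block_mx 1%:M 0 (- C') phi.
have wO : w *m O = row_mx 0 (x *m phi).
  by rewrite mul_row_block mulmx1 mulmx0 add0r mulmxN -yx subrr.
have detO : \det O = \det phi by rewrite det_lblock det1 mul1r.
have IwO : inI I (w *m O).
  move=> i j; rewrite wO mxE; case: split => k; last exact: hx.
  by rewrite mxE; apply: ideal0.
have IwO1 : inI I (w *m O1).
  move=> i j; rewrite wO1 mxE; case: split => k; first exact: hy1.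
  by rewrite mxE; apply: ideal0.
have /fin_all_exists [b hb] : forall j, exists b, bdry w (col j O - O1 *m b).
  by move=> j; apply: goodw; rewrite mul_colE.
pose be := \matrix_(i, j) b j i 0.
have hN : kos w (O - O1 *m be).
  move=> j; have := hb j; congr (bdry w _); apply/colP => i; rewrite !mxE; congr (_ - _).
  by apply: eq_bigr => k _; rewrite [be k j]mxE.
have IwOb : inI I (w *m (O1 *m be)) by rewrite mulmxA; apply: inI_mulr.
have := det_kos hI IwOb hN; rewrite [O1 *m be + _]addrC subrK detO det_mulmx => hdet.
have [|b' eb'] := hu (\det be).
  move/hM => [c ec]; apply: hd; apply: (idealBr hI hdet).
  rewrite ec; have -> : \det O1 * (y *m c) 0 0 = ((\det O1 *: w) *m col_mx c 0) 0 0.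
    by rewrite -scalemxAl [RHS]mxE mul_row_col mulmx0 addr0.
  rewrite mul_det; exact: (inI_mulr _ hI (inI_mulr _ hI IwO1)).
have ebe : be *m (b' *: \adj be) = 1%:M.
  by rewrite -scalemxAr mul_mx_adj scale_scalar_mx eb'.
move=> z hz; have [|b0 hb0] := goodw (col_mx 0 z).
  by rewrite mul_row_col mulmx0 add0r.
set g := b' *: \adj be in ebe.
have hw : bdry w (col_mx 0 z - O *m (g *m b0)).
  have -> : col_mx 0 z - O *m (g *m b0) = col_mx 0 z - O1 *m b0 - (O - O1 *m be) *m (g *m b0).
    rewrite mulmxBl opprB -(mulmxA O1) (mulmxA be) ebe mul1mx addrA subrK.
    by [].
  by apply: bdryB => //; apply: kos_mul.
exists (dsubmx (g *m b0)).
have -> : z - phi *m dsubmx (g *m b0) = row_mx C' 1%:M *m (col_mx 0 z - O *m (g *m b0)).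
  rewrite mulmxBr mul_row_col mulmx0 add0r mul1mx mulmxA mul_row_block mulmx1 mul1mx mulmx0 add0r subrr.
  by rewrite mul1mx -[X in row_mx _ _ *m X]vsubmxK mul_row_col mul0mx add0r.
apply: bdry_functor; have -> // : x *m row_mx C' 1%:M = w.
by rewrite mul_mx_row -yx mulmx1.
Qed.

End Boundaries.

(** The columns of [koszul_delta] come from elementary alternating matrices; conversely the entries
    of an alternating matrix, taken once per pair, are coordinates on these columns. *)
Lemma koszul_kos (A : comNzRingType) n (x : 'rV[A]_n) (a : 'M_n) :
  koszul_right_ideal x a <-> kos x a.
Proof.
split=> [[b ->] j|ha].
  have -> : col j (koszul_delta x *m b) = koszul_delta x *m col j b.
    by apply/colP => i; rewrite mul_colE mxE.
  apply: kos_mul => c.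
  set p := val (enum_val c); have hp : (p.1 < p.2)%N := valP (enum_val c).
  have np : p.1 != p.2 by rewrite -val_eqE /= neq_ltn hp.
  exists (delta_mx p.2 p.1 - delta_mx p.1 p.2); split.
    split=> [i|i k]; rewrite !mxE; last by rewrite opprB (andbC (k == _)) (andbC (k == p.1)).
    by rewrite andbC subrr.
  have e (i l k : 'I_n) : (delta_mx i l *m x^T) k 0 = (k == i)%:R * x 0 l.
    rewrite mxE (bigD1 l) //= big1 ?addr0 => [|q ql]; first by rewrite !mxE eqxx andbT.
    by rewrite !mxE (negPf ql) andbF mul0r.
  apply/colP => k; rewrite mulmxBl [RHS]mxE [X in _ + X]mxE !e !mxE -/p.
  rewrite /=; case: (eqVneq k p.1) => [->|k1]; first by rewrite (negPf np) /= mul0r sub0r mul1r.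
  by case: (eqVneq k p.2) => _ /=; rewrite ?mul1r ?mul0r subr0.
pose im (z : 'cV[A]_n) := exists b, z = koszul_delta x *m b.
have imD u v : im u -> im v -> im (u + v).
  by move=> [b ->] [b' ->]; exists (b + b'); rewrite mulmxDr.
have imZ r u : im u -> im (r *: u) by move=> [b ->]; exists (r *: b); rewrite scalemxAr.
have im0 : im 0 by exists 0; rewrite mulmx0.
pose g (i j : 'I_n) : 'cV[A]_n := x 0 i *: delta_mx j 0 - x 0 j *: delta_mx i 0.
have img (i j : 'I_n) : (i < j)%N -> im (g i j).
  move=> ij; pose p : koszul_pairs n := exist _ (i, j) ij.
  exists (delta_mx (enum_rank p) 0); apply/colP => k.
  rewrite [RHS]mxE (bigD1 (enum_rank p)) //= big1 ?addr0 => [|c cp]; last first.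
    by rewrite [delta_mx _ _ _ _]mxE (negPf cp) mulr0.
  rewrite !mxE enum_rankK !eqxx /= mulr1.
  case: (eqVneq k i) => [->|ki].
    by rewrite -val_eqE (ltn_eqF ij) mulr0 mulr1 add0r.
  by case: (eqVneq k j) => _; rewrite mulr0 ?mulr1 ?mulr0 subr0.
suff /fin_all_exists [b hb] : forall j, im (col j a).
  exists (\matrix_(c, j) b j c 0); apply/matrixP => k j.
  have := congr1 (fun C : 'cV_n => C k 0) (hb j); rewrite !mxE => ->.
  by apply: eq_bigr => c _; rewrite [in RHS]mxE.
move=> j; have [N [[N1 N2] ->]] := ha j.
have -> : N *m x^T = \sum_(i < n) \sum_(l < n) (if (i < l)%N then N l i *: g i l else 0).
  apply/colP => k; rewrite mxE summxE.
  transitivity (\sum_(i < n) \sum_(l < n)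
     ((if (i < l)%N then N l i * (x 0 i * (k == l)%:R) else 0) -
      (if (i < l)%N then N l i * (x 0 l * (k == i)%:R) else 0))); last first.
    apply: eq_bigr => i _; rewrite summxE; apply: eq_bigr => l _.
    by case: ifP => _; rewrite !mxE ?subr0 // !andbT mulrBr.
  rewrite (eq_bigr _ (fun i _ => sumrB _ _ _ _)) sumrB exchange_big /=.
  have single (G : 'I_n -> A) : (forall l, l != k -> G l = 0) -> \sum_l G l = G k.
    by move=> hG; rewrite (bigD1 k) //= big1 ?addr0.
  rewrite [X in _ = X - _]single => [|l lk]; last first.
    by rewrite big1 // => i _; rewrite eq_sym (negPf lk) !mulr0 if_same.
  rewrite [X in _ = _ - X]single => [|l lk]; last first.
    by rewrite big1 // => i _; rewrite eq_sym (negPf lk) !mulr0 if_same.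
  rewrite -sumrB; apply: eq_bigr => l _; rewrite eqxx !mulr1 !mxE (N2 k l).
  case: (ltngtP l k) => [||/val_inj ->]; rewrite ?subr0 ?sub0r ?mulNr ?opprK //.
by rewrite N1 mul0r.
elim/big_ind: _ => // i _; elim/big_ind: _ => // l _.
by case: ifP => // il; apply/imZ/img.
Qed.

(** * Wiebe's theorem in a regular local ring *)

Lemma row_factor (R : comNzRingType) n p (x : 'rV[R]_n) (v : 'rV_p) :
  (forall j, exists c : 'cV_n, v 0 j = (x *m c) 0 0) -> exists C, v = x *m C.
Proof.
move=> /fin_all_exists [c hc].
exists (\matrix_(i, j) c j i 0); apply/rowP => j; rewrite hc !mxE.
by apply: eq_bigr => i _; rewrite !mxE.
Qed.

Section RowIdeals.
Variable R : comNzRingType.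
Implicit Types (I J : R -> Prop) (F : nat -> R).

Definition rowf F n : 'rV[R]_n := \row_(i < n) F i.
Definition fun_row n (x : 'rV[R]_n) : nat -> R := ext (fun i => x 0 i).

Lemma fun_rowK n (x : 'rV[R]_n) : rowf (fun_row x) n = x.
Proof. by apply/rowP => i; rewrite mxE /fun_row extE. Qed.

Lemma idl_rowf F n a : idl F n a <-> exists c : 'cV_n, a = (rowf F n *m c) 0 0.
Proof.
split=> [[c ->]|[c ->]].
  by exists (\col_i c i); rewrite mxE; apply: eq_bigr => i _; rewrite !mxE mulrC.
exists (ext (fun i => c i 0)); rewrite mxE; apply: eq_bigr => i _.
by rewrite (extE (fun i => c i 0)) mxE mulrC.
Qed.
Lemma idl_fun_row n (x : 'rV[R]_n) a : idl (fun_row x) n a <-> exists c : 'cV_n, a = (x *m c) 0 0.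
Proof. by rewrite idl_rowf fun_rowK. Qed.
Lemma idl_Jrow n (x : 'rV[R]_n) a : Jrow x a <-> idl (fun_row x) n a.
Proof. by apply: idl_gen => i; rewrite /fun_row extE. Qed.
Lemma mem_idl_row n (x : 'rV[R]_n) j : idl (fun_row x) n (x 0 j).
Proof. by rewrite -[x 0 j](extE (fun i => x 0 i)); apply: mem_idl. Qed.

Lemma idl_mx p F n (v : 'rV[R]_p) : (forall j, idl F n (v 0 j)) -> exists C, v = rowf F n *m C.
Proof. by move=> h; apply: row_factor => j; apply/idl_rowf. Qed.

Lemma acyc_bdry F n (z : 'cV_n) : acyc F n -> rowf F n *m z = 0 -> bdry (rowf F n) z.
Proof.
move=> hF hz.
have [|N [[N1 N2] hN]] := hF (ext (fun i => z i 0)).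
  transitivity ((rowf F n *m z) 0 0); last by rewrite hz mxE.
  rewrite mxE; apply: eq_bigr => i _.
  by rewrite (extE (fun i => z i 0)) mxE mulrC.
exists (\matrix_(i, j) N i j); split.
  by split=> [i|i j]; rewrite !mxE.
apply/colP => i; have := hN i (ltn_ord i); rewrite (extE (fun i => z i 0)) => ->.
by rewrite mxE; apply: eq_bigr => j _; rewrite !mxE.
Qed.

Lemma bound_exists n (T : nat -> nat -> Prop) :
  (forall i, (i < n)%N -> exists t, T i t) -> (forall i t, T i t -> T i t.+1) ->
  exists N, forall i, (i < n)%N -> T i N.
Proof.
move=> h hT; have mono i s t : (s <= t)%N -> T i s -> T i t.
  elim: t => [|t IH]; first by rewrite leqn0 => /eqP ->.
  by rewrite leq_eqVlt => /orP[/eqP -> //|st] /(IH st) /hT.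
elim: n h => [|n IH] h; first by exists 0%N.
have [N hN] := IH (fun i hi => h i (ltnW hi)); have [t ht] := h n (ltnSn n).
exists (maxn N t) => i; rewrite ltnS leq_eqVlt => /orP[/eqP ->|/hN].
  by apply: mono ht; rewrite leq_maxr.
by apply: mono; rewrite leq_maxl.
Qed.

End RowIdeals.

Section RegularLocal.
Variable S : comNzRingType.
Hypothesis hS : noetherian S.
Variables (m : S -> Prop) (d : nat) (X : nat -> S).
Hypotheses (hm : local_with_max m) (mX : eq_ideal m (idl X d)) (regX : reg X d).
Let pm := local_prime hm.
Let im := prime_is_ideal pm.
Let mXi i : (i < d)%N -> m (X i). Proof. by move=> hi; apply/mX/mem_idl. Qed.

Lemma mprim_gen I : is_ideal I -> (forall i, (i < d)%N -> exists t, I (X i ^+ t)) -> mprim m I.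
Proof.
move=> hI h a ma; apply: NNPP => hn.
have [|P [hP [IP nPa]]] := @prime_powers S I a hS hI; first by move=> t ht; apply: hn; exists t.
apply: nPa; move/mX: ma; apply: idl_sub; first exact: prime_is_ideal.
by move=> i /h [t /IP /(primeX hP)].
Qed.

Lemma mprim_bound I : is_ideal I -> mprim m I -> exists N, forall i, (i < d)%N -> I (X i ^+ N).
Proof.
move=> hI h; apply: (@bound_exists d (fun i t => I (X i ^+ t))) => [i hi|i t ht].
  exact/h/mXi.
by rewrite exprS; apply: idealMl.
Qed.

Lemma reg_of_mprim G : (forall i, (i < d)%N -> m (G i)) -> mprim m (idl G d) -> reg G d.
Proof.
move=> mG hG; have [N hN] := mprim_bound (ideal_idl G d) hG.
have [||_ //] := @reg_inside S hS m hm G (fun i => X i ^+ N.+1) d mG.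
  exact: (@reg_pow S hS m hm X d (fun=> N.+1)).
by move=> k hk; rewrite exprS; apply: idealMl => //; apply: hN.
Qed.

(* Wiebe: perturbing [X Phi] inside [m K] makes it a regular sequence, whose socle is spanned
   by the determinant; as that determinant is not in [K], the sequence generates [K]. *)
Lemma wiebe_regular K (Phi : 'M_d) : is_ideal K -> mprim m K ->
  inI K (rowf X d *m Phi) -> ~ K (\det Phi) ->
  [/\ forall a, K a -> idl (fun_row (rowf X d *m Phi)) d a,
      reg (fun_row (rowf X d *m Phi)) d &
      exists o, (forall i, (i < d)%N -> K (o * X i)) /\
        forall a, (forall i, (i < d)%N -> K (a * X i)) -> exists b, K (a - b * o)].
Proof.
move=> hK pK hPhi hdet.
have nK1 : ~ K 1 by move=> K1; apply: hdet; rewrite -(mulr1 (\det Phi)); apply: idealMl.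
have Km a : K a -> m a by apply: local_proper.
have [N hN] := mprim_bound hK pK.
set G := fun_row (rowf X d *m Phi).
have KG i : (i < d)%N -> K (G i).
  by move=> hi; rewrite -[i]/(val (Ordinal hi)) /G /fun_row extE; apply: hPhi.
(* [X i ^+ N] is in [K], so [s i * F i] is [X i] times an element of [K]: the perturbation is a
   diagonal change of [Phi] by entries of [K]. *)
pose F i := X i ^+ N.+1.
have mF i : (i < d)%N -> m (F i) by move=> hi; apply: idealX => //; apply: mXi.
have pF : mprim m (idl F d).
  by apply: mprim_gen => // i hi; exists N.+1; apply: (@mem_idl _ F).
have [s hs] := local_avoid_seq hS G hm mF pF.
set G' := fun i => _ in hs.
have KG' i : (i < d)%N -> K (G' i).
  move=> hi; rewrite /G' /F exprS; apply: idealD => //; first exact: KG.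
  by do 2 apply: idealMl => //; apply: hN.
pose Phi' : 'M_d := Phi + diag_mx (\row_i (s i * X i ^+ N)).
have hdet' : ~ K (\det Phi').
  move=> h; apply: hdet; apply: (idealBl hK _ h); apply: det_mod => // i j.
  rewrite !mxE addrAC subrr add0r; case: eqVneq => _; last by rewrite mulr0n; apply: ideal0.
  by rewrite mulr1n; apply: idealMl => //; apply: hN.
have eG' : rowf X d *m Phi' = rowf G' d.
  apply/rowP => j; rewrite mulmxDr mxE [RHS]mxE /G' /G /fun_row extE; congr (_ + _).
  rewrite mxE (bigD1 j) //= big1 ?addr0 => [|i ij].
    by rewrite !mxE eqxx mulr1n /F exprS mulrCA.
  by rewrite !mxE (negPf ij) mulr0n mulr0.
have mG' i : (i < d)%N -> m (G' i) by move=> hi; apply/Km/KG'.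
have regG' : reg G' d by apply: reg_of_mprim.
have subK a : idl G' d a -> K a by apply: idl_sub.
have [|o [so ho]] := @reg_cyclic_socle S X G' d regG'; first by move=> k hk; apply/mX/mG'.
have detG' i : (i < d)%N -> idl G' d (\det Phi' * X i).
  move=> hi; apply/idl_rowf; exists (\adj Phi' *m delta_mx (Ordinal hi) 0).
  rewrite -eG' mulmxA -mul_det; rewrite mxE (bigD1 (Ordinal hi)) //= big1 ?addr0 => [|k ki].
    by rewrite !mxE !eqxx mulr1.
  by rewrite [delta_mx _ _ _ _]mxE (negPf ki) mulr0.
have KG'sub a : K a -> idl G' d a.
  move=> Ka; apply: NNPP => nGa.
  have [|b [nb hb]] := @socle_elt S (idl G' d) X d a (ideal_idl G' d) nGa.
    by move=> i hi; apply/hs/mXi.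
  have [c hc] := ho _ hb; have [c' hc'] := ho _ detG'.
  have mo r : m r -> idl G' d (r * o).
    move/mX => [q ->]; rewrite mulr_suml; apply: ideal_sum => // i _.
    by rewrite -mulrA [X i * o]mulrC; apply: idealMl => //; apply: so.
  have nmc : ~ m c by move=> /mo h; apply: nb; apply: (idealBr (ideal_idl _ _) hc h).
  have [u eu] := local_unit hS hm nmc.
  apply: hdet'; apply: (idealBr hK (subK _ hc')).
  have -> : c' * o = c' * u * (c * o) by rewrite -[o in LHS]mul1r -eu; ring.
  apply: idealMl => //; apply: (idealBl hK (subK _ hc)); exact: idealMl.
(* As [X j ^+ N] is in [K], hence in the ideal of [G'], each [G' j] is [G j] plus a combination of
   the [G' l] with coefficients in [m]. *)
have G'G i : (i < d)%N -> idl G d (G' i).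
  have [||||u [nu hu]] := @nakayama S S^o (idl G d) m d (fun i => G' i) pm.
  - exact: (ideal0 (ideal_idl _ _)).
  - by move=> a b; apply: (idealD (ideal_idl _ _)).
  - by move=> a b; apply: (idealMl _ (ideal_idl _ _)).
  - move=> j; have [c ec] := KG'sub _ (hN j (ltn_ord j)).
    exists 1, (G j), (fun l => s j * X j * c l); split.
    + exact: prime_n1.
    + exact: mem_idl.
    + by move=> l; apply: (idealMr _ im); apply: idealMl => //; apply: mXi.
    rewrite scale1r /G' /F exprS mulrA ec mulr_sumr; congr (_ + _); apply: eq_bigr => l _.
    by rewrite /GRing.scale /= mulrA.
  move=> hi; have [v ev] := local_unit hS hm nu.
  have := hu (Ordinal hi); rewrite /GRing.scale /= => h.
  by rewrite -[G' i]mul1r -ev -mulrA; apply: idealMl.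
have KGsub a : K a -> idl G d a by move=> /KG'sub; apply: idl_sub.
split=> //.
  by have [_] := @reg_inside S hS m hm G G' d (fun i hi => Km _ (KG i hi)) regG' G'G.
exists o; split=> [i hi|a ha]; first exact/subK/so.
have [|b hb] := ho a; first by move=> i hi; apply/KG'sub/ha.
by exists b; apply: subK.
Qed.

(** [D] and [Psi B] both carry [X] to the powers [F], so they differ by boundaries; [\det D] is the
    monomial excluded by [prod_notin_pow], and [det_factor_notin] passes the conclusion to [Psi]. *)
Lemma det_regular_notin f (Psi : 'M_d) : rowf f d = rowf X d *m Psi ->
  mprim m (idl f d) -> ~ idl f d (\det Psi).
Proof.
move=> ef pf; have [N hN] := mprim_bound (ideal_idl f d) pf.
pose F i := X i ^+ N.+1.
pose D : 'M_d := diag_mx (\row_i X i ^+ N).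
have eD : rowf X d *m D = rowf F d.
  apply/rowP => j; rewrite mxE (bigD1 j) //= big1 ?addr0 => [|i ij].
    by rewrite !mxE eqxx mulr1n /F exprS.
  by rewrite !mxE (negPf ij) mulr0n mulr0.
have [|B eB] := @idl_mx S d f d (rowf F d).
  by move=> j; rewrite mxE /F exprS; apply: idealMl => //; apply: hN.
have hDB : kos (rowf X d) (D - Psi *m B).
  have acX : acyc X d by have [] := @reg_inside S hS m hm X X d mXi regX (fun k hk => mem_idl X hk).
  move=> j; apply: acyc_bdry => //; apply/matrixP => i k.
  by rewrite !ord1 mul_colE mulmxBr mulmxA -ef -eB eD subrr !mxE.
move=> /idl_rowf [c ec].
apply: (@det_factor_notin S (idl F d) d (rowf X d) D Psi B (D - Psi *m B) c 0) => //.
- by move=> i j; rewrite ord1 eD mxE; apply: (@mem_idl _ F).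
- rewrite det_diag.
  have -> : \prod_(i < d) (\row_(i < d) X i ^+ N) 0 i = \prod_(i < d) X i ^+ ((fun=> N.+1) (i : nat)).-1.
    by apply: eq_bigr => i _; rewrite mxE.
  exact: (@prod_notin_pow S hS m hm X d (fun=> N.+1)).
- by rewrite addrC subrK.
- exact: (ideal0 (ideal_idl _ _)).
- by rewrite addr0 -ef.
Qed.

End RegularLocal.

(** * Quotients *)

Section IdealQuotient.
Variables (A : comNzRingType) (I : A -> Prop) (hI : is_ideal I) (n1 : ~ I 1).

Definition ideal_pred (a : A) : bool := if excluded_middle_informative (I a) then true else false.

Lemma ideal_predP a : reflect (I a) (ideal_pred a).
Proof. by rewrite /ideal_pred; case: excluded_middle_informative => h; constructor. Qed.

Lemma ideal_pred_closed : idealr_closed ideal_pred.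
Proof.
split; first by apply/ideal_predP; apply: ideal0.
  by apply/negP => /ideal_predP.
move=> a u v /ideal_predP hu /ideal_predP hv; apply/ideal_predP.
by apply: idealD => //; apply: idealMl.
Qed.
HB.instance Definition _ := isIdealr.Build A ideal_pred ideal_pred_closed.

Lemma ideal_quotient : exists (B : comNzRingType) (q : {rmorphism A -> B}),
  surj q /\ forall a, q a = 0 <-> I a.
Proof.
pose J : idealr A := ideal_pred.
pose Q : comNzRingType := {ideal_quot J}.
pose q : {rmorphism A -> Q} := (\pi_Q)%qT.
exists Q, q; split=> [b|a]; first by exists (repr b); rewrite /q /= reprK.
have -> : (q a = 0) <-> (q a == q 0) by rewrite rmorph0; split=> [->|/eqP].
by rewrite -Quotient.idealrBE subr0; split=> /ideal_predP.
Qed.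
End IdealQuotient.

Lemma mem_row (R : comNzRingType) n (x : 'rV[R]_n) j : exists c : 'cV_n, x 0 j = (x *m c) 0 0.
Proof. by apply/idl_fun_row; apply: mem_idl_row. Qed.

Lemma prefix_idl (R : comNzRingType) r (f : 'I_r -> R) (F : nat -> R) i a : (forall j : 'I_r, F j = f j) ->
  (i <= r)%N -> prefix_ideal f i a <-> idl F i a.
Proof.
move=> hF ir; split=> -[c ->].
  by apply: ideal_sum => // j ji; apply: idealMl => //; rewrite -hF; apply: mem_idl.
exists (fun j => c j); rewrite (big_ord_widen r (fun j => c j * F j) ir).
by apply: eq_bigr => j _; rewrite hF.
Qed.

Lemma gen_ideal_is_ideal (R : comNzRingType) r (f : 'I_r -> R) : is_ideal (gen_ideal f).
Proof.
have h := idl_gen (extE f); split; first by apply/h; apply: ideal0.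
by split=> [a b /h ha /h hb|t a /h ha]; apply/h; [apply: idealD|apply: idealMl].
Qed.

(** A prime missing the powers of [a] would lie strictly below [M], a chain of length one. *)
Lemma zero_dim_nilpotent (A : comNzRingType) (M : A -> Prop) a : noetherian A ->
  local_with_max M -> krull_dim A 0 -> M a -> exists t, a ^+ t = 0.
Proof.
move=> hA hM [_ hdim] Ma; apply: NNPP => hn.
have [|P [hP [_ nPa]]] := @prime_powers A (fun b => b = 0) a hA (ideal_zero A).
  by move=> t ht; apply: hn; exists t.
apply: hdim; exists (fun i => if i == 0%N then P else M); split.
  by move=> [|i] _ //=; apply: local_prime hM.
move=> [|//] _ /=; split; last by move=> h; apply/nPa/h.
by move=> b; apply: (local_proper hA hM (prime_is_ideal hP) (prime_n1 hP)).
Qed.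

Section QuotientMap.
Variables (A B : comNzRingType) (q : {rmorphism A -> B}) (M : A -> Prop).
Hypotheses (hA : noetherian A) (hM : local_with_max M) (hq : surj q).
Hypothesis kerM : forall a, q a = 0 -> M a.
Let pM := local_prime hM.
Let iM := prime_is_ideal pM.

Lemma preim_ideal J : is_ideal J -> is_ideal (fun a => J (q a)).
Proof.
move=> hJ; split; first by rewrite rmorph0; apply: (ideal0 hJ).
by split=> [a b ha hb|r a ha]; rewrite ?rmorphD ?rmorphM; [apply: (idealD hJ)|apply: (idealMl _ hJ)].
Qed.

Lemma preim_prime P : prime_ideal P -> prime_ideal (fun a => P (q a)).
Proof.
move=> [[hP n1] h]; split; last by move=> a b; rewrite rmorphM; apply: h.
by split; [apply: preim_ideal|rewrite rmorph1].
Qed.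

Lemma noetherian_image : noetherian B.
Proof.
move=> J hJ; have [n [f hf]] := hA (preim_ideal hJ).
exists n, (fun i => q (f i)) => b; split=> [|[c ->]].
  have [a <-] := hq b => /hf [c ->]; exists (fun i => q (c i)).
  by rewrite rmorph_sum; apply: eq_bigr => i _; rewrite rmorphM.
apply: ideal_sum => // i _; apply: idealMl => //; apply/hf.
exists (fun j => (j == i)%:R); rewrite (bigD1 i) //= eqxx mul1r big1 ?addr0 // => j /negPf ->.
by rewrite mul0r.
Qed.

Definition image_ideal b := exists a, M a /\ q a = b.

Lemma image_ideal_mem a : image_ideal (q a) <-> M a.
Proof.
split=> [[a' [Ma' e]]|Ma]; last by exists a.
have : M (a' - a) by apply: kerM; rewrite rmorphB e subrr.
by move/(idealBl iM); apply.
Qed.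

Lemma local_image : local_with_max image_ideal.
Proof.
have iI : is_ideal image_ideal.
  split; first by exists 0; rewrite rmorph0; split=> //; apply: ideal0.
  split=> [_ _ [a [ha <-]] [b [hb <-]]|r _ [a [ha <-]]].
    by exists (a + b); rewrite rmorphD; split=> //; apply: idealD.
  by have [r' <-] := hq r; exists (r' * a); rewrite rmorphM; split=> //; apply: idealMl.
have nI : ~ image_ideal 1 by rewrite -(rmorph1 q) => /image_ideal_mem; apply: prime_n1.
split.
  split=> // J hJ MJ; case: (hM) => -[_ hmax] _.
  case: (hmax _ (preim_ideal hJ)) => [a /image_ideal_mem /MJ //|h|]; last first.
    by rewrite rmorph1; right.
  by left=> b; have [a <-] := hq b; split=> [/h /image_ideal_mem|/MJ].
move=> N [[iN nN] Nmax]; have NM b : N b -> image_ideal b.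
  have [a <-] := hq b => Na; apply/image_ideal_mem.
  by apply: (local_proper hA hM (preim_ideal iN)) => //; rewrite rmorph1.
by have [h b|//] := Nmax _ iI NM; split=> /h.
Qed.

Lemma krull_dim_image : krull_dim A 0 -> krull_dim B 0.
Proof.
move=> [_ hdim]; split.
  exists (fun=> image_ideal); split=> // i _; exact: (local_prime local_image).
move=> [P [h1 h2]]; apply: hdim; exists (fun i a => P i (q a)); split=> [i hi|i hi].
  by apply: preim_prime; apply: h1.
have [h3 h4] := h2 i hi; split=> [a|h]; first exact: h3.
by apply: h4 => b; have [a <-] := hq b; apply: h.
Qed.

End QuotientMap.

Lemma regular_sequence_reg (S : comNzRingType) (d : nat) (G : nat -> S) (m : S -> Prop) :
  prime_ideal m -> (forall i, (i < d)%N -> m (G i)) -> reg G d ->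
  regular_sequence (fun i : 'I_d => G i).
Proof.
move=> pm mG hG; split.
  move/(idl_gen (fun _ => erefl)) => h; apply: (prime_n1 pm).
  by apply: idl_sub h => //; apply: prime_is_ideal.
move=> i a; have h b : prefix_ideal (fun i : 'I_d => G i) i b <-> idl G i b.
  by apply: prefix_idl => //; apply: ltnW.
by move=> /h; move/(hG i a (ltn_ord i)) => ?; apply/h.
Qed.

(* The ideal [(f)] is generated by as many elements as [m]: height gives [d <= r], and the
   Koszul complex of generators of [m] gives [r <= d]. *)
Lemma CI0_presentation (A : comNzRingType) (M : A -> Prop) : CI0 A -> local_with_max M ->
  exists (S : comNzRingType) (pi : {rmorphism S -> A}) (m : S -> Prop) (d : nat) (X : nat -> S)
    (Psi : 'M[S]_d),
  [/\ surj pi, regular_local S, local_with_max m & forall s, m s <-> M (pi s)] /\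
  [/\ eq_ideal m (idl X d), reg X d,
      inI (fun s => pi s = 0) (rowf X d *m Psi) & pi (\det Psi) <> 0].
Proof.
move=> [hA [_ [dimA [S [pi [hpi [hS [r [f [[nf hf] kerf]]]]]]]]]] hM.
have pM := local_prime hM; have iM := prime_is_ideal pM.
have [nS [m [d [hm [[[C hC] _] [X0 mX0]]]]]] := hS.
have pm := local_prime hm; have im := prime_is_ideal pm.
pose X := ext X0; have mX : eq_ideal m (idl X d) by move=> s; rewrite mX0; apply: idl_gen; apply: extE.
have mXi i : (i < d)%N -> m (X i) by move=> hi; apply/mX/mem_idl.
pose F := ext f; have hF := idl_gen (extE f).
have ker_m s : pi s = 0 -> m s.
  by move/kerf; apply: (local_proper nS hm (gen_ideal_is_ideal f) nf).
have mM s : m s <-> M (pi s).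
  split=> [ms|Ms].
    apply: NNPP => nM; have [b eb] := local_unit hA hM nM; have [b' eb'] := hpi b.
    apply: (prime_n1 pm); apply: (@idealBl _ m (b' * s) 1) => //; last exact: idealMl.
    by apply: ker_m; rewrite rmorphB rmorphM eb' eb rmorph1 subrr.
  apply: (local_proper nS hm (preim_ideal pi iM)) => //.
  by rewrite rmorph1; apply: prime_n1.
have prF : mprim m (idl F r).
  move=> s /mM /(zero_dim_nilpotent hA hM dimA) [t et]; exists t; apply/hF/kerf.
  by rewrite rmorphXn.
have mF i : (i < r)%N -> m (F i).
  by move=> hi; apply/ker_m/kerf/hF/mem_idl.
have regF : reg F r.
  move=> k a kr; have h b : prefix_ideal f k b <-> idl F k b.
    by apply: prefix_idl; [apply: extE|apply: ltnW].
  have e : F k = f (Ordinal kr) by rewrite -(extE f).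
  by rewrite e => /h ha; apply/h/(hf (Ordinal kr)).
have dr : (d <= r)%N.
  apply: (@krull_height S nS r d m F C pm _ hC).
    split=> [i hi|P hP PF Pm a /prF [t ht]]; first exact: mF.
    apply: (@primeX _ P a t) => //; apply: idl_sub ht => //; exact: prime_is_ideal.
  have [hC1 _] := hC; have pd := hC1 d (leqnn d).
  by move=> a; apply: (local_proper nS hm (prime_is_ideal pd) (prime_n1 pd)).
have XF k : (k < r)%N -> idl X d (F k) by move=> hk; apply/mX/mF.
have rd : (r <= d)%N by apply: (reg_length hm (F := X) (f := F)).
have {dr rd} rd : r = d by apply/eqP; rewrite eqn_leq dr rd.
subst r; have [_ regX] := reg_inside nS hm mXi regF XF.
have [|Psi ePsi] := @idl_mx S d X d (rowf F d); first by move=> j; rewrite mxE; apply: XF.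
exists S, pi, m, d, X, Psi; split=> //; split=> //.
  by rewrite -ePsi => i j; rewrite mxE; apply/kerf/hF/mem_idl.
move/kerf/hF; exact: (det_regular_notin nS hm mX regX ePsi prF).
Qed.

(** * Wiebe matrices and complete intersection ideals of [A] *)

Section Correspondence.
Variables (A : comNzRingType) (M : A -> Prop).
Hypotheses (hA : noetherian A) (dimA : krull_dim A 0) (hM : local_with_max M).
Variables (S : comNzRingType) (pi : {rmorphism S -> A}) (m : S -> Prop) (d : nat) (X : nat -> S).
Hypotheses (hpi : surj pi) (hS : regular_local S) (hm : local_with_max m).
Hypotheses (mM : forall s, m s <-> M (pi s)) (mX : eq_ideal m (idl X d)) (regX : reg X d).
Let nS : noetherian S := proj1 hS.
Let pm := local_prime hm.
Let pM := local_prime hM.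
Let iM := prime_is_ideal pM.
Let y : 'rV[A]_d := map_mx pi (rowf X d).

Let lift_mx p r (B : 'M[A]_(p, r)) : exists C, map_mx pi C = B.
Proof.
have /fin_all_exists [C hC] : forall i, exists c : 'I_r -> S, forall j, pi (c j) = B i j.
  move=> i; have /fin_all_exists [c hc] : forall j, exists s, pi s = B i j by move=> j; apply: hpi.
  by exists c.
by exists (\matrix_(i, j) C i j); apply/matrixP => i j; rewrite !mxE.
Qed.

Lemma max_ideal_row a : M a <-> exists c : 'cV_d, a = (y *m c) 0 0.
Proof.
split=> [Ma|[c ->]].
  have [s es] := hpi a; rewrite -es in Ma *.
  have /idl_rowf [c ->] := proj1 (mX s) (proj2 (mM s) Ma).
  by exists (map_mx pi c); rewrite -map_mxM [RHS]mxE.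
rewrite mxE; apply: ideal_sum => // i _; apply: idealMr => //; rewrite !mxE.
by apply/mM/mX/mem_idl.
Qed.

(** Everything is lifted to [S], with [K] the preimage of [I]; [K] is [m]-primary because [M] is
    nilpotent elementwise, so [wiebe_regular] applies. A lifted relation is a boundary because [X]
    is regular, and its image in [A] is still a boundary. *)
Lemma wiebe_quotient I (phi : 'M_d) : is_ideal I -> inI I (y *m phi) -> ~ I (\det phi) ->
  [/\ CI0_ideal I,
      forall z : 'cV_d, I ((y *m z) 0 0) -> exists b, bdry y (z - phi *m b) &
      exists o, (forall r, M r -> I (r * o)) /\
        forall a, (forall r, M r -> I (r * a)) -> exists b, I (a - b * o)].
Proof.
move=> hI hy hdet; have [Phi ePhi] := lift_mx phi.
have nI1 : ~ I 1 by move=> I1; apply: hdet; rewrite -[\det _]mulr1; apply: idealMl.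
have IM a : I a -> M a by apply: local_proper.
pose K s := I (pi s).
have hK : is_ideal K by apply: preim_ideal.
have prK : mprim m K.
  move=> s /mM /(zero_dim_nilpotent hA hM dimA) [t et]; exists t.
  by rewrite /K rmorphXn /= et; apply: ideal0.
have KPhi : inI K (rowf X d *m Phi).
  move=> i j; rewrite /K; have -> : pi ((rowf X d *m Phi) i j) = (y *m phi) i j; last exact: hy.
  by rewrite -ePhi -map_mxM [RHS]mxE.
have Kdet : ~ K (\det Phi) by rewrite /K -det_map_mx ePhi.
have [KG regG [o [so ho]]] := wiebe_regular nS hm mX regX hK prK KPhi Kdet.
set G := fun_row _ in KG regG.
have mG i : (i < d)%N -> m (G i).
  move=> hi; apply/mM/IM; rewrite -[i]/(val (Ordinal hi)) /G /fun_row extE; exact: KPhi.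
have acX : acyc X d.
  by have [] := @reg_inside S nS m hm X X d (fun i hi => proj2 (mX _) (mem_idl X hi)) regX
    (fun k hk => mem_idl X hk).
split.
- split; first by split.
  have [B [q [hq kerq]]] := ideal_quotient hI nI1.
  have kerM a : q a = 0 -> M a by move/kerq/IM.
  exists B, q; split=> //; split=> //.
  split; first exact: (noetherian_image hA hq).
  split; first by exists (image_ideal q M); apply: local_image.
  split; first by apply: (krull_dim_image hA hM hq).
  exists S, (q \o pi : {rmorphism S -> B}); split.
    by move=> b; have [a <-] := hq b; have [s <-] := hpi a; exists s.
  split=> //; exists d, (fun i : 'I_d => G i); split.
    exact: (regular_sequence_reg pm).
  move=> s; rewrite /= kerq -/(K s); have h := @idl_gen S d (fun i : 'I_d => G i) G (fun _ => erefl).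
  split=> [/KG|/h]; first by move=> ?; apply/h.
  apply: idl_sub => // i hi; rewrite -[i]/(val (Ordinal hi)) /G /fun_row extE; exact: KPhi.
- move=> z hz; have [Z eZ] := lift_mx z.
  have : K ((rowf X d *m Z) 0 0).
    by move: hz; rewrite /K -eZ -map_mxM mxE.
  move/KG/idl_fun_row => [c ec].
  have : bdry (rowf X d) (Z - Phi *m c).
    apply: acyc_bdry => //; apply/matrixP => i j; rewrite !ord1 mulmxBr mulmxA mxE ec [in RHS]mxE.
    by rewrite [X in _ + X]mxE subrr.
  move=> [N [[N1 N2] eN]]; exists (map_mx pi c), (map_mx pi N); split.
    by split=> [i|i j]; rewrite !mxE ?N1 ?rmorph0 // N2 rmorphN.
  by rewrite -ePhi -eZ -map_mxM -map_mxB eN map_mxM map_trmx.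
exists (pi o); split=> [r Mr|a ha].
  have [s es] := hpi r; rewrite -es in Mr *.
  have [c ->] := proj1 (mX s) (proj2 (mM s) Mr).
  rewrite -rmorphM mulr_suml; apply: (ideal_sum _ hK) => i _.
  by rewrite -mulrA [X i * o]mulrC; apply: (idealMl _ hK); apply: so.
have [s es] := hpi a; have [|b hb] := ho s.
  move=> i hi; rewrite /K rmorphM mulrC es; apply: ha.
  by apply/mM/mX/mem_idl.
by exists (pi b); rewrite -es -rmorphM -rmorphB.
Qed.

Variables (n : nat) (x : 'rV[A]_n).
Hypothesis hx : eq_ideal M (Jrow x).

Let Mx a : M a <-> exists c : 'cV_n, a = (x *m c) 0 0.
Proof. by rewrite hx idl_Jrow idl_fun_row. Qed.

Let xy : exists C, x = y *m C.
Proof. by apply: row_factor => j; apply/max_ideal_row/Mx/mem_row. Qed.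
Let yx : exists C, y = x *m C.
Proof. by apply: row_factor => j; apply/Mx/max_ideal_row/mem_row. Qed.

Lemma wiebe_CI0_ideal I (phi : 'M_n) : is_ideal I -> inI I (x *m phi) -> ~ I (\det phi) ->
  CI0_ideal I /\ forall z : 'cV_n, I ((x *m z) 0 0) -> exists b, bdry x (z - phi *m b).
Proof.
move=> hI hphi hdet; have [C eC] := xy; have [C' eC'] := yx.
have [phi' [h1 h2]] := wiebe_transfer hI eC eC' hphi hdet.
have [ci good _] := wiebe_quotient hI h1 h2; split=> //.
apply: (wiebe_generates hI _ _ h1 good eC eC' hphi hdet).
  by move=> b; apply: (local_unit hA hM).
by move=> a /max_ideal_row.
Qed.

(** The socle argument is repeated in [A], as [n] may differ from [d]. After transfer to [y],
    [wiebe_quotient] for [J] shows that [A/J] has a cyclic socle; an element of [I] outside [J]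
    would bring its generator, and so [\det phi], into [I]. *)
Lemma wiebe_equals I (phi : 'M_n) : is_ideal I -> inI I (x *m phi) -> ~ I (\det phi) ->
  eq_ideal I (Jrow (x *m phi)).
Proof.
move=> hI hphi hdet; have [C eC] := xy; have [C' eC'] := yx.
set J := Jrow _; have iJ : is_ideal J by apply: gen_ideal_is_ideal.
have JI a : J a -> I a.
  by move=> [c ->]; apply: ideal_sum => // i _; apply: idealMl.
have JP a : J a <-> exists c : 'cV_n, a = (x *m phi *m c) 0 0 by rewrite /J idl_Jrow idl_fun_row.
have hphiJ : inI J (x *m phi) by move=> i j; rewrite ord1; apply/JP/mem_row.
have hdetJ : ~ J (\det phi) by move/JI.
have [phi' [h1 h2]] := wiebe_transfer iJ eC eC' hphiJ hdetJ.
have [_ _ [o [so ho]]] := wiebe_quotient iJ h1 h2.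
have [c' hc'] : exists c', J (\det phi - c' * o).
  apply: ho => r /Mx [c ->]; apply/JP; exists (\adj phi *m c).
  by rewrite mulmxA -mul_det -scalemxAl [RHS]mxE mulrC.
move=> a; split=> [Ia|]; last exact: JI.
apply: NNPP => nJa.
have [|b [nb hb]] := @socle_elt A J (fun_row x) n a iJ nJa.
  move=> i hi; have [t et] : exists t, fun_row x i ^+ t = 0.
    by apply: (zero_dim_nilpotent hA hM dimA); apply/hx/idl_Jrow/mem_idl.
  by exists t; rewrite et; apply: ideal0.
have [c hc] : exists c, J (b * a - c * o).
  apply: ho => r /hx /idl_Jrow [e ->]; rewrite mulr_suml; apply: ideal_sum => // i _.
  by rewrite -mulrA [fun_row x i * _]mulrC; apply: idealMl => //; apply: hb.
have nMc : ~ M c by move=> /so h; apply: nb; apply: (idealBr iJ hc h).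
have [u eu] := local_unit hA hM nMc.
apply: hdet; apply: (idealBr hI (JI _ hc')).
have -> : c' * o = c' * u * (c * o) by rewrite -[o in LHS]mul1r -eu; ring.
by apply: idealMl => //; apply: (idealBl hI (JI _ hc)); apply: idealMl.
Qed.

(** The quotient [B] has its own regular presentation [S'], unrelated to [S]. Its matrix [Psi']
    gives a Wiebe matrix over [B], which is transferred to the image of [x] and lifted to [A] entry
    by entry. *)
Lemma CI0_ideal_wiebe I : CI0_ideal I ->
  exists phi : 'M_n, inI I (x *m phi) /\ ~ I (\det phi).
Proof.
move=> [[hI nI1] [B [q [hq [kerq hB]]]]].
have kerM a : q a = 0 -> M a by move/kerq; apply: local_proper.
have hMB := local_image hA hM hq kerM.
have [S' [pi' [m' [d' [X' [Psi' [[hpi' _ _ mM'] [mX' _ h1 h2]]]]]]]] := CI0_presentation hB hMB.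
pose y' : 'rV[B]_d' := map_mx pi' (rowf X' d'); pose x' := map_mx q x.
have hy' b : image_ideal q M b <-> exists c : 'cV_d', b = (y' *m c) 0 0.
  split=> [Mb|[c ->]].
    have [s es] := hpi' b; rewrite -es in Mb *.
    have /idl_rowf [c ->] := proj1 (mX' s) (proj2 (mM' s) Mb).
    by exists (map_mx pi' c); rewrite -map_mxM [RHS]mxE.
  have iMB := prime_is_ideal (local_prime hMB).
  rewrite mxE; apply: ideal_sum => // i _; apply: idealMr => //; rewrite !mxE.
  by apply/mM'/mX'/mem_idl.
have hx' b : image_ideal q M b <-> exists c : 'cV_n, b = (x' *m c) 0 0.
  have [a <-] := hq b; rewrite image_ideal_mem // Mx; split=> -[c].
    by move=> ->; exists (map_mx q c); rewrite -map_mxM [RHS]mxE.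
  move=> e; apply/Mx/(image_ideal_mem hM kerM); rewrite e mxE.
  have iMB := prime_is_ideal (local_prime hMB).
  apply: ideal_sum => // i _; apply: idealMr => //; rewrite mxE.
  by apply/(image_ideal_mem hM kerM)/Mx/mem_row.
have [C eC] : exists C, x' = y' *m C by apply: row_factor => j; apply/hy'/hx'/mem_row.
have [C' eC'] : exists C, y' = x' *m C by apply: row_factor => j; apply/hx'/hy'/mem_row.
have [||phib [h3 h4]] := @wiebe_transfer B (fun b => b = 0) d' n y' x' C' C (map_mx pi' Psi')
  (ideal_zero B) eC' eC.
- by move=> i j; rewrite -map_mxM mxE; apply: h1.
- by rewrite det_map_mx.
have /fin_all_exists [phi0 hphi0] : forall i, exists c : 'I_n -> A, forall j, q (c j) = phib i j.
  move=> i; have /fin_all_exists [c hc] : forall j, exists s, q s = phib i j by move=> j; apply: hq.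
  by exists c.
pose phi : 'M_n := \matrix_(i, j) phi0 i j.
have ephi : map_mx q phi = phib by apply/matrixP => i j; rewrite !mxE.
exists phi; split=> [i j|/kerq]; last by rewrite -det_map_mx ephi.
by apply/kerq; have := h3 i j; rewrite -ephi -map_mxM mxE.
Qed.

End Correspondence.

(** * The correspondence *)

Lemma cyclic_subP (A : comNzRingType) n (x : 'rV[A]_n) (phi alpha : 'M_n) :
  cyclic_sub x phi alpha <-> exists beta, kos x (alpha - phi *m beta).
Proof. by split=> -[beta h]; exists beta; apply/koszul_kos. Qed.

Lemma cyclic_sub_columns (A : comNzRingType) n (x : 'rV[A]_n) (phi alpha : 'M_n) :
  (forall j, exists b, bdry x (col j alpha - phi *m b)) -> cyclic_sub x phi alpha.
Proof.
move=> /fin_all_exists [b hb]; apply/cyclic_subP; exists (\matrix_(i, j) b j i 0) => j.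
have := hb j; congr (bdry x _); apply/colP => i; rewrite !mxE; congr (_ - _).
by apply: eq_bigr => k _; rewrite mxE.
Qed.

Lemma cyclic_sub_trans (A : comNzRingType) n (x : 'rV[A]_n) (phi phi' alpha : 'M_n) :
  cyclic_sub x phi phi' -> cyclic_sub x phi' alpha -> cyclic_sub x phi alpha.
Proof.
move=> /cyclic_subP [b hb] /cyclic_subP [c hc]; apply/cyclic_subP; exists (b *m c) => j.
have -> : col j (alpha - phi *m (b *m c)) =
    col j (alpha - phi' *m c) + (phi' - phi *m b) *m col j c.
  apply/colP => i; rewrite [RHS]mxE mul_colE mulmxBl !mulmxA !mxE; ring.
by apply: bdryD => //; apply: kos_mul.
Qed.

Lemma cyclic_sub_refl (A : comNzRingType) n (x : 'rV[A]_n) (phi : 'M_n) : cyclic_sub x phi phi.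
Proof.
apply/cyclic_subP; exists 1%:M => j; rewrite mulmx1 subrr.
have -> : col j (0 : 'M[A]_n) = 0 by apply/colP => i; rewrite !mxE.
exact: bdry0.
Qed.

Theorem theorem6p12 (A : comNzRingType) (M : A -> Prop) (n : nat)
  (x : 'rV[A]_n) (psi : 'M[A]_n)
  (hA : CI0 A) (hM : local_with_max M)
  (hx : eq_ideal M (Jrow x))
  (hpsi : x_Wiebe x psi) :
  (* the correspondence is well defined: for phi x-nice, J(x.phi) is a
     C.I.0-ideal and (phi.M_n(A)+N)/N is a cyclic submodule containing M_0 *)
  (forall phi, x_nice x phi ->
     CI0_ideal (Jrow (x *m phi)) /\
     (forall alpha, cyclic_sub x psi alpha -> cyclic_sub x phi alpha)) /\
  (* every C.I.0-ideal is of the form J(x.phi) with phi x-nice *)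
  (forall I, CI0_ideal I ->
     exists phi, x_nice x phi /\ eq_ideal I (Jrow (x *m phi))) /\
  (* every cyclic submodule containing M_0 is (phi.M_n(A)+N)/N with phi x-nice *)
  (forall phi, (forall alpha, cyclic_sub x psi alpha -> cyclic_sub x phi alpha) ->
     exists phi', x_nice x phi' /\
       forall alpha, cyclic_sub x phi alpha <-> cyclic_sub x phi' alpha) /\
  (* the correspondence is well defined and injective *)
  (forall phi phi', x_nice x phi -> x_nice x phi' ->
     (eq_ideal (Jrow (x *m phi)) (Jrow (x *m phi')) <->
      forall alpha, cyclic_sub x phi alpha <-> cyclic_sub x phi' alpha)).
Proof.
have [nA [_ [dimA _]]] := hA.
have [S [pi [m [d [X [_ [[hpi hS hm mM] [mX regX _ _]]]]]]]] := CI0_presentation hA hM.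
have rowJ (phi : 'M[A]_n) a : Jrow (x *m phi) a <-> exists c : 'cV_n, a = (x *m phi *m c) 0 0.
  by rewrite idl_Jrow idl_fun_row.
have iJ (phi : 'M[A]_n) : is_ideal (Jrow (x *m phi)) by apply: gen_ideal_is_ideal.
have memJ (phi : 'M[A]_n) : inI (Jrow (x *m phi)) (x *m phi) by move=> i j; rewrite ord1; apply/rowJ/mem_row.
have nice phi : x_nice x phi -> CI0_ideal (Jrow (x *m phi)) /\
    forall alpha, inI (Jrow (x *m phi)) (x *m alpha) -> cyclic_sub x phi alpha.
  move=> hphi; have [ci good] := wiebe_CI0_ideal nA dimA hM hpi hS hm mM mX regX hx
    (iJ phi) (memJ phi) hphi.
  split=> // alpha halpha; apply: cyclic_sub_columns => j.
  by apply: good; rewrite mul_colE.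
have [xpsi dpsi] := hpsi.
split.
  move=> phi /nice [ci hphi]; split=> // alpha; apply: cyclic_sub_trans; apply: hphi.
  by rewrite xpsi => i j; rewrite mxE; apply: ideal0.
split.
  move=> I hI; have iI := hI.1.1.
  have [phi [h1 h2]] := CI0_ideal_wiebe nA hM hx hI.
  have e := wiebe_equals nA dimA hM hpi hS hm mM mX regX hx iI h1 h2.
  by exists phi; split=> //; move/e.
split.
  (* The given generator is already nice: [psi] is [phi b] up to boundaries, and [det_factor_notin]
     applies with the zero ideal. *)
  move=> phi h; exists phi; split=> //.
  have /cyclic_subP [b hb] := h psi (cyclic_sub_refl x psi).
  move/rowJ => [c ec].
  apply: (@det_factor_notin A (fun a => a = 0) n x psi phi b (psi - phi *m b) c 0 (ideal_zero A)) => //.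
  - by rewrite xpsi => i j; rewrite mxE.
  - exact/eqP.
  - by rewrite addrC subrK.
  - by rewrite addr0.
move=> phi phi' hphi hphi'; split=> [e alpha|h].
  split; apply: cyclic_sub_trans.
    by apply: (proj2 (nice _ hphi')) => i j; apply/e/memJ.
  by apply: (proj2 (nice _ hphi)) => i j; apply/e/memJ.
(* [x] annihilates boundaries, so a larger cyclic submodule has a larger ideal. *)
have sub (f g : 'M_n) : cyclic_sub x f g -> forall a, Jrow (x *m g) a -> Jrow (x *m f) a.
  move=> /cyclic_subP [b hb] a /rowJ [c ->]; apply/rowJ; exists (b *m c).
  rewrite !mulmxA; have := mul_kos hb; rewrite mulmxBr => /eqP; rewrite subr_eq0 => /eqP ->.
  by rewrite !mulmxA.
move=> a; split; apply: sub; apply/h; exact: cyclic_sub_refl.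
Qed.
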